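(* Let $\mathbb{F}$ be an algebraically closed field with $\operatorname{char}\mathbb{F}\neq 2$, let $n\geq 2$, and let $Q=Q(n)=Q^{\bar 0}\oplus Q^{\bar 1}$ be either the simple Lie superalgebra $Q(n)$ over $\mathbb{F}$ (in which case assume in addition that $\operatorname{char}\mathbb{F}$ does not divide $n+1$) or the simple Jordan superalgebra $Q(n)$ over $\mathbb{F}$. Let $G$ be an abelian group, let $\Gamma$ be a $G$-grading on the algebra $Q^{\bar 0}$, and let $h\in G$ be the distinguished element associated to $\Gamma$. Then the $G$-gradings on the superalgebra $Q$ extending $\Gamma$ (i.e., whose restriction to $Q^{\bar 0}$ is $\Gamma$) are precisely the gradings of the form $\Gamma\oplus\underline{\Gamma}^{[d]}$, where $d\in G$ is such that $d^2=h$.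
   Context: Groups are written multiplicatively with identity $e$. All spaces are finite-dimensional over $\mathbb{F}$. **The superalgebras.** $M_k$ is the algebra of $k\times k$ matrices over $\mathbb{F}$. For $A_k=M_k\oplus uM_k$, the associative superalgebra with even part $M_k$ and odd part $uM_k$, where $u$ is odd, commutes with $M_k$ and $u^2=1$: - Lie case: $Q(n)$ is the quotient by its center $\mathbb{F}1$ of the derived superalgebra of $A_{n+1}$ under the supercommutator $[x,y]=xy-(-1)^{ij}yx$ ($x$ of parity $i$, $y$ of parity $j$). When $\operatorname{char}\mathbb{F}\nmid n+1$, put $a^\sharp=a-\frac{1}{n+1}\operatorname{tr}(a)1$; then $Q(n)$ is identified (via $a+ub+\mathbb{F}1\mapsto(a^\sharp,b)$) with $\mathfrak{sl}(n+1)\oplus\mathfrak{sl}(n+1)$ (even part $\oplus$ odd part). Writing $x$ for $(x,0)$ and $\underline{x}$ for $(0,x)$, the bracket is $[a,b]=ab-ba$, $[a,\underline{b}]=\underline{ab-ba}$, $[\underline{a},\underline{b}]=(ab+ba)^\sharp$ (and $[\underline b,a]=-[a,\underline b]$). So $Q^{\bar 0}=\mathfrak{sl}(n+1)$. - Jordan case: $Q(n)$ is $A_n$ with the product $x\circ y=xy+(-1)^{ij}yx$. It is identified with $M_n\oplus M_n$ via $a+ub\mapsto(a,b)$; writing $x$ for $(x,0)$ and $\underline{x}$ for $(0,x)$, the product is $a\circ b=ab+ba$, $a\circ\underline{b}=\underline{b}\circ a=\underline{ab+ba}$, $\underline{a}\circ\underline{b}=ab-ba$. So $Q^{\bar 0}=M_n^{(+)}$,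 the Jordan algebra $M_n$ with product $ab+ba$. In both cases $x\mapsto\underline{x}$ is an isomorphism of $Q^{\bar 0}$-modules $Q^{\bar 0}\to Q^{\bar 1}$. **Gradings.** A $G$-grading on a superalgebra $A$ is a vector space decomposition $A=\bigoplus_{g\in G}A_g$ with $A_gA_k\subseteq A_{gk}$ and $A_g=(A_g\cap A^{\bar 0})\oplus(A_g\cap A^{\bar 1})$ for all $g,k\in G$. For ordinary algebras (zero odd part) the second condition is vacuous. A $G$-grading on a vector space is just a decomposition indexed by $G$. **Type and distinguished element.** Let $S=\mathfrak{sl}(n+1)$ and $R=M_{n+1}$ (Lie case) or $S=M_n^{(+)}$ and $R=M_n$ (Jordan case). A $G$-grading $\Gamma$ on $S=Q^{\bar 0}$ is of Type I if it is the restriction to $S$ of a $G$-grading of the associative algebra $R$ (in the Jordan case: if it is a grading of the associative algebra $M_n$), and of Type II otherwise. If $\Gamma$ is of Type II, there is a unique element $h\in G$ of order $2$ such that the coarsening of $\Gamma$ induced by $G\to G/\langle h\rangle$ (the component of degree $g\langle h\rangle$ being $S_g\oplus S_{gh}$) is of Type I; this $h$ is the distinguished element of $\Gamma$. If $\Gamma$ is of Type I, its distinguished element is $h=e$. **Notation.** For a $G$-grading $\Gamma:V=\bigoplus_g V_g$ on a vector space and $d\in G$, the shift $\Gamma^{[d]}$ is the $G$-grading obtained by relabeling the component $V_g$ as $V_{gd}$ for all $g$. For a $G$-grading $\Gamma$ on $Q^{\bar 0}$, $\underline{\Gamma}$ is the $G$-grading on $Q^{\bar 1}$ with components $\{\underline{x}\mid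 x\in Q^{\bar 0}_g\}$. For $G$-gradings $\Gamma$ on $V=Q^{\bar 0}$ and $\Delta$ on $W=Q^{\bar 1}$, $\Gamma\oplus\Delta$ is the decomposition of $V\oplus W$ with components $V_g\oplus W_g$. *)

(* Defs.v *)
From HB Require Import structures.
From mathcomp Require Import all_boot all_order all_algebra.
From mathcomp Require Import ring_quotient.

Set Implicit Arguments.
Unset Strict Implicit.
Unset Printing Implicit Defensive.

Import GRing.Theory.
Local Open Scope ring_scope.

(* Abelian groups are [zmodType]s, hence written additively: the group law is
   [+], the identity is [0], and d^2 = h reads [d *+ 2 = h]. *)

Section Gradings.

Variables (F : fieldType) (G : zmodType) (V : vectType F).
Implicit Types (U : {vspace V}) (Gam : G -> {vspace V}) (mul : V -> V -> V).

(* V is finite-dimensional, so a direct decomposition has finite support. *)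
Definition decomposition U Gam : Prop :=
  exists s : seq G,
    [/\ uniq s,
        forall g, g \notin s -> Gam g = 0%VS,
        directv (\sum_(g <- s) Gam g)
      & (\sum_(g <- s) Gam g = U)%VS].

(* The algebra is the subspace U of V with the product [mul]. *)
Definition grading mul U Gam : Prop :=
  decomposition U Gam /\
  forall g k x y, x \in Gam g -> y \in Gam k -> mul x y \in Gam (g + k).

(* The superalgebra is U0 (+) U1, with even part U0 and odd part U1. *)
Definition super_grading mul (U0 U1 : {vspace V}) Gam : Prop :=
  grading mul (U0 + U1)%VS Gam /\
  forall g, Gam g = (Gam g :&: U0 + Gam g :&: U1)%VS.

Definition shift (d : G) Gam : G -> {vspace V} := fun g => Gam (g - d).

Definition grading_sum (Gam Del : G -> {vspace V}) : G -> {vspace V} :=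
  fun g => (Gam g + Del g)%VS.

Definition restricts_to U (Del Gam : G -> {vspace V}) : Prop :=
  forall g, (Del g :&: U)%VS = Gam g.

End Gradings.

Section QuotientByInvolution.

Variables (G : zmodType) (h : G) (h2 : h *+ 2 = 0).

(* The subgroup <h>; the proof that 2h = 0 is an argument so that the library's
   quotient group [{quot cyc2 h2}] can be formed. *)
Definition cyc2 of h *+ 2 = 0 : {pred G} := [pred x | (x == 0) || (x == h)].

Fact cyc2_zmod_closed : zmod_closed (cyc2 h2).
Proof.
have hN : - h = h by apply/eqP; rewrite eq_sym -addr_eq0 -mulr2n h2.
split=> [|x y]; first by rewrite inE eqxx.
rewrite !inE => /orP[]/eqP-> /orP[]/eqP->;
  by rewrite ?subr0 ?sub0r ?hN ?subrr -?mulr2n ?h2 ?eqxx ?orbT.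
Qed.

HB.instance Definition _ :=
  GRing.isZmodClosed.Build G (cyc2 h2) cyc2_zmod_closed.

Definition quot2 : zmodType := Quotient.quot (cyc2 h2).

(* [repr q] is one of the two elements of the coset q; see [coarseningE]. *)
Definition coarsening (F : fieldType) (V : vectType F) (Gam : G -> {vspace V}) :
    quot2 -> {vspace V} :=
  fun q => (Gam (repr q) + Gam (repr q + h)%R)%VS.

Lemma coarseningE (F : fieldType) (V : vectType F) (Gam : G -> {vspace V}) g :
  coarsening Gam (\pi_(Quotient.quot (cyc2 h2))%qT g) = (Gam g + Gam (g + h)%R)%VS.
Proof.
rewrite /coarsening; set r := repr _.
have : r = g %[mod (Quotient.quot (cyc2 h2))]%qT by rewrite reprK.
move/eqP; rewrite -Quotient.idealrBE !inE subr_eq0 subr_eq.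
case/orP=> /eqP->//; rewrite [h + g]addrC -addrA -mulr2n h2 addr0.
exact: addvC.
Qed.

End QuotientByInvolution.

Arguments coarsening {G h} h2 {F V} Gam q.

Variant Q_kind := LieQ | JordanQ.

Definition Qsize (kind : Q_kind) (n : nat) : nat :=
  match kind with LieQ => n.+1 | JordanQ => n end.

Section SuperalgebraQ.

Variables (F : fieldType) (kind : Q_kind) (n : nat).

Local Notation R := 'M[F]_(Qsize kind n).
Implicit Types (a b : R).

Definition trace0 : {vspace R} :=
  lker (linfun (mxtrace : R -> F^o)).

Lemma trace0E a : (a \in trace0) = (\tr a == 0).
Proof. by rewrite memv_ker lfunE. Qed.

(* The space on which both the even and the odd part of Q(n) are modelled. *)
Definition Qbase : {vspace R} :=
  match kind with LieQ => trace0 | JordanQ => fullv end.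

Definition sharp a : R := a - ((Qsize kind n)%:R^-1 * \tr a)%:M.

(* Product of the even part. *)
Definition even_mul a b : R :=
  match kind with
  | LieQ => a *m b - b *m a
  | JordanQ => a *m b + b *m a
  end.

(* Product of two odd elements. *)
Definition odd_mul a b : R :=
  match kind with
  | LieQ => sharp (a *m b + b *m a)
  | JordanQ => a *m b - b *m a
  end.

(* The pair (a, b) stands for a + \underline{b}.  For an odd element
   \underline{b} and an even one a, the product \underline{b} a is
   -[a, b] = [b, a] in the Lie case and b o a in the Jordan case, i.e. it is
   [even_mul b a] underlined in both cases. *)
Definition Qmul (x y : R * R) : R * R :=
  (even_mul x.1 y.1 + odd_mul x.2 y.2, even_mul x.1 y.2 + even_mul x.2 y.1).

Definition pairv (U W : {vspace R}) : {vspace R * R} :=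
  ((linfun fst @^-1: U) :&: (linfun snd @^-1: W))%VS.

Lemma pairvE U W (x : R * R) : (x \in pairv U W) = (x.1 \in U) && (x.2 \in W).
Proof. by rewrite memv_cap -!memv_preim !lfunE. Qed.

Definition evenv (U : {vspace R}) : {vspace R * R} := pairv U 0.
Definition underline (U : {vspace R}) : {vspace R * R} := pairv 0 U.

Definition Qeven : {vspace R * R} := evenv Qbase.
Definition Qodd : {vspace R * R} := underline Qbase.

(* A grading of the Lie, resp. Jordan, algebra [Qbase] is of Type I if it is the
   restriction of a grading of the associative matrix algebra; for
   [Qbase = fullv] this says that it is itself such a grading. *)
Definition typeI (G : zmodType) (Gam : G -> {vspace R}) : Prop :=
  exists Theta : G -> {vspace R},
    grading mulmx fullv Theta /\ restricts_to Qbase Theta Gam.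

Definition distinguished (G : zmodType) (Gam : G -> {vspace R}) (h : G) : Prop :=
  (typeI Gam /\ h = 0) \/
  [/\ ~ typeI Gam, h != 0
    & exists h2 : h *+ 2 = 0, typeI (coarsening h2 Gam)].

End SuperalgebraQ.

Arguments Qbase F kind n : clear implicits.
Arguments even_mul F kind n : clear implicits.
Arguments Qmul F kind n : clear implicits.
Arguments Qeven F kind n : clear implicits.
Arguments Qodd F kind n : clear implicits.

(* Main.v *)
Require Import Defs.
From HB Require Import structures.
From mathcomp Require Import all_boot all_order all_algebra.
From mathcomp Require Import ring_quotient ring.

(* Write a * b for [odd_mul a b], seen as a product on the even part S.  Two
   rigidity facts drive the proof: a linear map commuting with the multiplications
   of S is a scalar, and a bilinear map S x S -> S with the symmetry and the
   derivation property of * is a multiple of *.  The homogeneous parts of the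
   identity map from S to the odd part, and those of *, inherit these properties,
   so they are multiples of the identity and of *.  Hence each of the two maps has
   a single degree: the odd part is graded by the shift of Gam by some d, and *
   has a degree h0 with respect to Gam; comparing the two gives d + d = h0.
   Finally Gam is of Type I iff h0 = 0, because 2ab is the sum of the even product
   of a and b, of a * b and of a scalar matrix; applied to the coarsening, this
   yields h0 = h. *)

Set Implicit Arguments.
Unset Strict Implicit.
Unset Printing Implicit Defensive.

Import GRing.Theory.
Local Open Scope ring_scope.

(** The only conditions on the characteristic are that 2, and in the Lie case n + 1, be invertible,
    so complete reducibility is not at hand and rigidity is computed on matrix units. In the Lie
    case S contains no diagonal unit [e i i]; maps on S are extended to all matrices by composing
    with [sharp], which does not affect brackets. The derivation property has two forms. In the Lie
    case a * b is symmetric and each bracket with an element of S derives it; in the Jordan case it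
    is the commutator, and each a * _ is a derivation of the even product. A homogeneous part
    inherits these identities because multiplying by a homogeneous element shifts all degrees alike.
    A nonzero part is then a nonzero multiple of the whole map, which leaves room for one degree
    only. The scalar matrix in 2ab is the delicate point of the Lie case: it must have degree 0, so
    the trace of ab has to vanish unless the degrees of a and b are opposite. Conversely, Type I
    forces degree 0 on a * b because 1 has degree 0 in every grading of the matrix algebra. *)

Local Ltac mx_ring :=
  rewrite ?(mulmxDl, mulmxDr, mulmxBl, mulmxBr, mulmxN, mulNmx, scalerDr, scalerBr,
    scalerN);
  rewrite -?scalemxAl -?scalemxAr ?mulmxA ?mulmx1 ?mul1mx;
  (* Each product monomial becomes an unknown matrix; the identity is then linear in these unknowns
     and can be checked entry by entry. *)
  repeat match goal with |- context [@mulmx ?R ?m ?n ?p ?a ?b] =>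
    move: (@mulmx R m n p a b) => ? end;
  repeat match goal with |- context [@scalar_mx ?R ?n ?a] =>
    move: (@scalar_mx R n a) => ? end;
  intros; apply/matrixP => ? ?; rewrite !mxE; ring.

(** * Matrix units and rigidity of equivariant maps *)

Section MatrixUnits.

Variables (F : fieldType) (N : nat).
Local Notation M := 'M[F]_N.
Local Notation e i j := (delta_mx i j : M).
Implicit Types (a b c X : M) (i j k l p q : 'I_N).

Definition lie a b : M := a *m b - b *m a.
Definition jor a b : M := a *m b + b *m a.

Lemma mul_deltaE i j X p q : (e i j *m X) p q = X j q *+ (p == i).
Proof.
rewrite mxE (bigD1 j) //= big1 ?addr0 => [|k kj]; last first.
  by rewrite mxE (negbTE kj) andbF mul0r.
by rewrite mxE eqxx andbT; case: eqP => _; rewrite ?mul1r ?mul0r.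
Qed.

Lemma mulr_deltaE i j X p q : (X *m e i j) p q = X p i *+ (q == j).
Proof.
rewrite mxE (bigD1 i) //= big1 ?addr0 => [|k ki]; last first.
  by rewrite mxE (negbTE ki) mulr0.
by rewrite mxE eqxx /=; case: eqP => _; rewrite ?mulr1 ?mulr0.
Qed.

Lemma lie_delta i j k l :
  lie (e i j) (e k l) = e i l *+ (j == k) - e k j *+ (l == i).
Proof. by rewrite /lie !mul_delta_mx_cond. Qed.

Lemma jor_delta i j k l :
  jor (e i j) (e k l) = e i l *+ (j == k) + e k j *+ (l == i).
Proof. by rewrite /jor !mul_delta_mx_cond. Qed.

Lemma lie_deltaE i j X p q :
  lie (e i j) X p q = X j q *+ (p == i) - X p i *+ (q == j).
Proof.
rewrite -mul_deltaE -mulr_deltaE /lie.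
by move: (_ *m _) (_ *m _) => A B; rewrite !mxE.
Qed.

Lemma lie_delta_diag i j X : (forall p q, p != q -> X p q = 0) ->
  lie (e i j) X = (X j j - X i i) *: e i j.
Proof.
move=> Xd; apply/matrixP => p q; rewrite lie_deltaE !mxE.
have [->|pi] := eqVneq p i; have [->|qj] := eqVneq q j; rewrite ?mulr1n ?mulr0n
  ?mulr1 ?mulr0 //.
- by rewrite subr0 Xd // eq_sym.
- by rewrite Xd // subr0.
- by rewrite subr0.
Qed.

Lemma lie_delta_diag_eq0 X : (forall k, lie (e k k) X = 0) ->
  forall p q, p != q -> X p q = 0.
Proof.
move=> Xk p q pq; have /matrixP/(_ p q) := Xk p.
by rewrite lie_deltaE mxE eqxx eq_sym (negbTE pq) subr0.
Qed.

Lemma lie_delta_eq0 k l X : lie (e k l) X = 0 -> X k k = X l l.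
Proof.
by move=> /matrixP/(_ k l)/eqP; rewrite lie_deltaE mxE !eqxx subr_eq0 => /eqP.
Qed.

Lemma lieC a b : lie a b = - lie b a.
Proof. by rewrite /lie opprB. Qed.

Lemma bilinear_eq0 (f : {bilinear M -> M -> M}) :
  (forall i j k l, f (e i j) (e k l) = 0) -> forall a b, f a b = 0.
Proof.
move=> f0 a b; rewrite (matrix_sum_delta a) (matrix_sum_delta b).
rewrite linear_sumlz big1 // => i _; rewrite linear_sumlz big1 // => j _.
rewrite linear_sumr big1 // => k _; rewrite linear_sumr big1 // => l _.
by rewrite linearZlr /= f0 !scaler0.
Qed.

(** * Symmetric bilinear maps invariant under the Lie action *)

Section LieEquivariant.

Variable f : {bilinear M -> M -> M}.
Hypothesis f_sym : forall a b, f a b = f b a.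
Hypothesis f_equiv : forall c a b, lie c (f a b) = f (lie c a) b + f a (lie c b).
Hypothesis char2 : 2%:R != 0 :> F.
Let D i j := f (e i i) (e j j).

(** Each [lie (e k k)] kills [e i i] and [e j j], so [D i j] commutes with all diagonal units. *)
Let D_diag i j p q : p != q -> D i j p q = 0.
Proof.
apply: lie_delta_diag_eq0 => k; rewrite f_equiv !lie_delta.
by rewrite [i == k]eq_sym [j == k]eq_sym; case: eqP => [->|_]; case: eqP => [->|_];
  rewrite ?subrr ?linear0l ?linear0r ?addr0.
Qed.

(** [lie (e k l)] kills both arguments of [D i j] when k and l avoid i and j, so [e k l] commutes
    with [D i j]. *)
Let D_const i j k l : k != i -> k != j -> l != i -> l != j -> D i j k k = D i j l l.
Proof.
move=> ki kj li lj; apply: lie_delta_eq0; rewrite f_equiv !lie_delta.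
rewrite (negbTE li) (negbTE lj) ![_ == k]eq_sym (negbTE ki) (negbTE kj) ?mulr1n
  ?mulr0n.
by rewrite subrr linear0l linear0r addr0.
Qed.

Let mul2_inj (X Y : M) : X *+ 2 = Y *+ 2 -> X = Y.
Proof. by rewrite -!scaler_nat => /(scalerI char2). Qed.

(** Apply [lie (e i j)] to [f (e i i) (e i i)]: the two derived terms coincide by symmetry, whence
    the factor 2. *)
Let f_ij_ii i j : i != j -> f (e i j) (e i i) *+ 2 = (D i i i i - D i i j j) *: e i j.
Proof.
move=> ij; have := f_equiv (e i j) (e i i) (e i i).
rewrite -/(D i i) (lie_delta_diag _ _ (@D_diag i i)) lie_delta eqxx eq_sym (negbTE
  ij) ?mulr1n ?mulr0n.
rewrite sub0r linearNl linearNr (f_sym (e i i)) -opprD -mulr2n => E.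
by rewrite -[LHS]opprK -E -scaleNr opprB.
Qed.

Let f_ij_jj i j : i != j -> f (e i j) (e j j) *+ 2 = (D j j j j - D j j i i) *: e i j.
Proof.
move=> ij; have := f_equiv (e i j) (e j j) (e j j).
rewrite -/(D j j) (lie_delta_diag _ _ (@D_diag j j)) lie_delta eqxx [j == i]eq_sym
  (negbTE ij) ?mulr1n ?mulr0n.
by rewrite subr0 (f_sym (e j j)) -mulr2n => <-.
Qed.

(** Apply [lie (e j i)] to [f (e i j) (e i i)], whose double is known from [f_ij_ii]. *)
Let f_ij_ji i j : i != j ->
  (D i i i i - D i i j j) *: (e j j - e i i) = (D j i - D i i + f (e i j) (e j i))
    *+ 2.
Proof.
move=> ij; have := f_equiv (e j i) (e i j) (e i i).
rewrite !lie_delta !eqxx (negbTE ij) ?mulr1n ?mulr0n subr0 linearBl => <-.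
have -> : e j j - e i i = lie (e j i) (e i j) by rewrite lie_delta !eqxx ?mulr1n.
rewrite mulr2n -[lie _ _ + _]/((mulmx _ _ - mulmx _ _) + (mulmx _ _ - mulmx _ _)).
rewrite addrACA -opprD -mulmxDr -mulmxDl -mulr2n f_ij_ii //.
by rewrite /lie -scalemxAl -scalemxAr -scalerBr.
Qed.

(** Subtract from [f_ij_ji] the same relation with i and j exchanged: [D i j] and
    [f (e i j) (e j i)] are symmetric in i and j and cancel. *)
Let D_ii i j : i != j ->
  (D j j - D i i) *+ 2
  = ((D i i i i - D i i j j) + (D j j j j - D j j i i)) *: (e j j - e i i).
Proof.
move=> ij; have ji : j != i by rewrite eq_sym.
rewrite scalerDl f_ij_ji // -[e j j - _]opprB scalerN f_ij_ji // -mulrnBl.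
congr (_ *+ 2).
rewrite (f_sym (e j i)) [D i j]f_sym -/(D j i).
by rewrite opprD addrACA subrr addr0 opprB addrC addrA subrK.
Qed.

Variables (i0 i1 i2 : 'I_N).
Hypotheses (i01 : i0 != i1) (i02 : i0 != i2) (i12 : i1 != i2).
Hypotheses (H00 : D i0 i0 i0 i0 = 0) (H01 : D i0 i0 i1 i1 = 0).

Let third i j : exists2 k, k != i & k != j.
Proof.
have [h0|] := boolP ((i0 != i) && (i0 != j)); first by case/andP: h0; exists i0.
have [h1 _|] := boolP ((i1 != i) && (i1 != j)); first by case/andP: h1; exists i1.
rewrite !negb_and !negbK => H1 H0; exists i2; apply: contraNneq i01 => E; move: H0 H1;
 rewrite -E (negbTE i02) (negbTE i12) ?orbF /= => /eqP-> /eqP->; exact: eqxx.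
Qed.

Let D_eq0 (X : M) : (forall p q, p != q -> X p q = 0) -> (forall k, X k k = 0) -> X
  = 0.
Proof.
move=> Xd X0; apply/matrixP => p q; rewrite mxE.
by have [->|/Xd] := eqVneq p q.
Qed.

Let D00 : D i0 i0 = 0.
Proof.
apply: D_eq0 => [p q|k]; first exact: D_diag.
have [->//|k0] := eqVneq k i0.
by rewrite (@D_const i0 i0 k i1) // eq_sym.
Qed.

(** Comparison with [D i0 i0 = 0] makes twice [D i i] a multiple of [e i i - e i0 i0]. Its entry at
    a third index is 0, hence by [D_const] so is the one at [i0], and the multiple vanishes. *)
Let Dii i : D i i = 0.
Proof.
have [->//|ji] := eqVneq i i0.
have := D_ii (i := i0) (j := i); rewrite eq_sym ji => /(_ isT).
rewrite D00 subr0 !mxE subrr add0r => E.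
have [k ki k0] := third i i0.
have Dk : D i i k k = 0.
  apply/eqP; rewrite -(mulrI_eq0 _ (mulfI char2)) mulr_natl.
  move/matrixP/(_ k k): E; rewrite !mxE (negbTE ki) (negbTE k0) subrr mulr0.
  by rewrite mulr2n => ->.
have DX l : l != i -> D i i l l = 0 by move=> li; rewrite (@D_const i i l k).
have D0 : D i i i0 i0 = 0 by rewrite DX // eq_sym.
move: E; rewrite D0 subr0 => E.
move/matrixP/(_ i0 i0)/eqP: (E); rewrite !mxE [i0 == i]eq_sym (negbTE ji) eqxx.
rewrite D0 ?mul0rn ?addr0 sub0r mulrN1 eq_sym oppr_eq0 => /eqP Ei.
by apply: mul2_inj; rewrite E Ei scale0r mul0rn.
Qed.

Let f_ij_ii0 i j : i != j -> f (e i j) (e i i) = 0.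
Proof. by move=> ij; apply: mul2_inj; rewrite f_ij_ii // Dii !mxE subrr scale0r
  mul0rn. Qed.

Let f_ij_jj0 i j : i != j -> f (e i j) (e j j) = 0.
Proof. by move=> ij; apply: mul2_inj; rewrite f_ij_jj // Dii !mxE subrr scale0r
  mul0rn. Qed.

Let f_ij_ji0 i j : i != j -> f (e i j) (e j i) = - D i j.
Proof.
move=> ij; apply/eqP; rewrite -addr_eq0 [D i j]f_sym -/(D j i) addrC; apply/eqP.
apply: mul2_inj; have := f_ij_ji ij; rewrite Dii subr0 => <-.
by rewrite !mxE subrr scale0r mul0rn.
Qed.

Let D_ij_eq i j : i != j -> D i j i i = D i j j j.
Proof.
move=> ij; have := f_equiv (e i j) (e i i) (e j j).
rewrite -/(D i j) (lie_delta_diag _ _ (@D_diag i j)) !lie_delta !eqxx.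
rewrite ![j == i]eq_sym (negbTE ij) ?mulr1n ?mulr0n sub0r subr0 linearNl f_ij_jj0 //
  oppr0 add0r.
rewrite f_sym f_ij_ii0 // => /matrixP/(_ i j); rewrite !mxE !eqxx mulr1.
by move/eqP; rewrite subr_eq0 => /eqP.
Qed.

Let f_ik_jj i j k : i != k -> j != i -> j != k ->
  f (e i k) (e j j) = (D i j i i - D i j k k) *: e i k.
Proof.
move=> ik ji jk; have := f_equiv (e i k) (e i i) (e j j).
rewrite -/(D i j) (lie_delta_diag _ _ (@D_diag i j)) !lie_delta !eqxx.
rewrite [k == i]eq_sym [k == j]eq_sym (negbTE ik) (negbTE ji) (negbTE jk) ?mulr1n
  ?mulr0n.
rewrite ?sub0r oppr0 linear0r addr0 linearNl => /eqP.
by rewrite eq_sym eqr_oppLR -scaleNr opprB => /eqP->.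
Qed.

Let f_ik_jj' i j k : i != k -> j != i -> j != k ->
  f (e i k) (e j j) = (D k j k k - D k j i i) *: e i k.
Proof.
move=> ik ji jk; have := f_equiv (e i k) (e k k) (e j j).
rewrite -/(D k j) (lie_delta_diag _ _ (@D_diag k j)) !lie_delta !eqxx.
rewrite [k == i]eq_sym [k == j]eq_sym (negbTE ik) (negbTE ji) (negbTE jk) ?mulr1n
  ?mulr0n.
by rewrite subr0 subrr linear0r addr0.
Qed.

Hypotheses (K0 : D i0 i1 i0 i0 = 0) (K2 : D i0 i1 i2 i2 = 0).

(** For j distinct from i and k, this is the eigenvalue of [f^~ (e j j)] on [e i k], by [f_ik_jj].
    It turns out to be independent of the indices, and [K0], [K2] make it vanish for [i0], [i1],
    [i2]. *)
Let gam i j k := D i j i i - D i j k k.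

Let gam_k i j k l : k != i -> k != j -> l != i -> l != j -> gam i j k = gam i j l.
Proof. by move=> ki kj li lj; rewrite /gam (@D_const i j k l). Qed.

Let gam_sym i j k : i != j -> gam i j k = gam j i k.
Proof. by move=> ij; rewrite /gam D_ij_eq // /D f_sym. Qed.

(** [f (e i k) (e j j)] is computed twice, from [D i j] and from [D k j]. *)
Let gam_swap i j k : i != k -> j != i -> j != k -> gam i j k = gam k j i.
Proof.
move=> ik ji jk; have := f_ik_jj ik ji jk; rewrite f_ik_jj' //.
by move/matrixP/(_ i k); rewrite !mxE !eqxx !mulr1.
Qed.

Let gam_row j i k i' k' : i != j -> k != j -> k != i -> i' != j -> k' != j -> k' !=
  i' ->
  gam i j k = gam i' j k'.
Proof.
move=> ij kj ki ij' kj' ki'; have [E|ii] := eqVneq i i'.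
  by rewrite E; apply: gam_k; rewrite // -?E.
rewrite (@gam_k i j k i') // 1?eq_sym // gam_swap // 1?eq_sym //.
by apply: gam_k; rewrite // eq_sym.
Qed.

Let gam0 i j k : i != j -> k != j -> k != i -> gam i j k = 0.
Proof.
have G0 i' k' : i' != i0 -> k' != i0 -> k' != i' -> gam i' i0 k' = 0.
  move=> h1 h2 h3; rewrite (@gam_row i0 i' k' i1 i2) // 1?eq_sym //.
  by rewrite gam_sym 1?eq_sym // /gam K0 K2 subrr.
move=> ij kj ki; have [E|j0] := eqVneq j i0; first by rewrite E G0 -?E.
have [l l0 lj] := third i0 j.
by rewrite (@gam_row j i k i0 l) // 1?eq_sym // gam_sym 1?eq_sym // G0.
Qed.

Let f_ik_jj0 i j k : i != k -> f (e i k) (e j j) = 0.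
Proof.
move=> ik; have [->|ji] := eqVneq j i; first exact: f_ij_ii0.
have [->|jk] := eqVneq j k; first exact: f_ij_jj0.
by rewrite f_ik_jj // -/(gam i j k) gam0 ?scale0r // eq_sym.
Qed.

Let lie0 a : lie a 0 = 0.
Proof. by rewrite /lie mulmx0 mul0mx subrr. Qed.

Let f_ij_jk0 i j k : i != j -> j != k -> i != k -> f (e i j) (e j k) = 0.
Proof.
move=> ij jk ik; have := f_equiv (e i j) (e j j) (e j k).
rewrite f_sym (f_ik_jj0 _ jk) lie0 !lie_delta !eqxx.
rewrite ![_ == i]eq_sym (negbTE ij) (negbTE ik) ?mulr1n ?mulr0n ?subr0.
by rewrite [f (e j j) _]f_sym f_ik_jj0 // addr0.
Qed.

(** [lie (e k i)] applied to [f (e i j) (e j k) = 0] gives [f (e k j) (e j k) = f (e i j) (e j i)],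
    and [f_ij_ji0] turns both sides into values of [D]. *)
Let D_row i j k : i != j -> j != k -> i != k -> D k j = D i j.
Proof.
move=> ij jk ik; have := f_equiv (e k i) (e i j) (e j k).
rewrite f_ij_jk0 // lie0 !lie_delta !eqxx.
rewrite [j == k](negbTE jk) [i == j](negbTE ij) ?mulr1n ?mulr0n subr0 sub0r linearNr.
rewrite !f_ij_ji0 // 1?eq_sym // opprK addrC => /esym/eqP.
by rewrite subr_eq0 => /eqP.
Qed.

Let D_ij i j : D i j = 0.
Proof.
have D_sym p q : D p q = D q p by rewrite /D f_sym.
(* [K0] and [K2] settle one off-diagonal pair; [D_row] and symmetry then reach all the others. *)
have D1 : D i1 i0 = 0.
  rewrite D_sym; apply: D_eq0 => [p q|k]; first exact: D_diag.
  have [->//|k0] := eqVneq k i0; have [->|k1] := eqVneq k i1.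
    by rewrite -D_ij_eq.
  by rewrite (@D_const i0 i1 k i2) // eq_sym.
have row p q k : p != q -> k != q -> D p q = D k q.
  move=> pq kq; have [->//|pk] := eqVneq p k.
  by rewrite (@D_row k q p) // eq_sym.
have [->|ij] := eqVneq i j; first exact: Dii.
have col0 k : k != i0 -> D k i0 = 0.
  by move=> k0; rewrite (row k i0 i1) // eq_sym.
have [E|j0] := eqVneq j i0; first by rewrite E col0 // -E.
by rewrite (row i j i0) // 1?eq_sym // D_sym col0.
Qed.

(* Once f vanishes on all (X, e k k), equivariance under e k l kills the rest. *)
Lemma lie_equivariant_eq0 a b : f a b = 0.
Proof.
have f_kk X k : f X (e k k) = 0.
  rewrite (matrix_sum_delta X) linear_sumlz big1 // => i _.
  rewrite linear_sumlz big1 // => j _; rewrite linearZl_LR /=.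
  have [->|ij] := eqVneq i j; last by rewrite f_ik_jj0 // scaler0.
  by rewrite -/(D j k) D_ij scaler0.
apply: bilinear_eq0 => i j k l; have [->|kl] := eqVneq k l; first exact: f_kk.
have := f_equiv (e k l) (e i j) (e k k).
rewrite !f_kk lie0 add0r lie_delta eqxx [l == k]eq_sym (negbTE kl) ?mulr1n ?mulr0n
  sub0r linearNr.
by move/esym/eqP; rewrite oppr_eq0 => /eqP.
Qed.

End LieEquivariant.
End MatrixUnits.

Section EquivariantBilinear.

Variables (F : fieldType) (N : nat).
Local Notation M := 'M[F]_N.
Local Notation e i j := (delta_mx i j : M).
Implicit Types (a b c X : M) (i j k l p q : 'I_N).
Hypothesis char2 : 2%:R != 0 :> F.

Lemma lie_jor a b c : lie c (jor a b) = jor (lie c a) b + jor a (lie c b).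
Proof. rewrite /lie /jor; mx_ring. Qed.

Let mxtraceB a b : \tr (a - b) = \tr a - \tr b.
Proof. exact: raddfB. Qed.

Lemma mxtrace_lie a b : \tr (lie a b) = 0.
Proof. by rewrite mxtraceB mxtrace_mulC subrr. Qed.

Lemma mxtrace_mul_lie a b c : \tr (lie c a *m b) = - \tr (a *m lie c b).
Proof.
rewrite /lie mulmxBl mulmxBr !mxtraceB !mulmxA opprB.
by rewrite -(mulmxA c) mxtrace_mulC.
Qed.

Lemma mxtrace_delta i j : \tr (e i j) = (i == j)%:R.
Proof.
rewrite /mxtrace (bigD1 i) //= mxE eqxx big1 ?addr0 // => k ki.
by rewrite mxE (negbTE ki).
Qed.

Section BilinearClassification.

Variable f : {bilinear M -> M -> M}.
Hypothesis f_sym : forall a b, f a b = f b a.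
Hypothesis f_equiv : forall c a b, lie c (f a b) = f (lie c a) b + f a (lie c b).
Variables x y u v : F.

(** What is subtracted is the general symmetric bilinear map invariant under the Lie action: a
    four-parameter family built from [jor], the trace and the identity matrix. *)
Definition equivariant_defect a b : M :=
  f a b - (x *: jor a b + (y * \tr a) *: b + (y * \tr b) *: a
           + (u * \tr (a *m b) + v * (\tr a * \tr b)) *: 1%:M).

Lemma equivariant_defect_bilinear : bilinear_for *:%R *:%R equivariant_defect.
Proof.
split=> a s b c; rewrite /equivariant_defect /jor.
  rewrite linearPl mulmxDl mulmxDr -scalemxAl -scalemxAr !linearP /=; mx_ring.
rewrite linearPr mulmxDl mulmxDr -scalemxAl -scalemxAr !linearP /=; mx_ring.
Qed.

HB.instance Definition _ := bilinear_isBilinear.Build F M M M *:%R *:%R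
  equivariant_defect equivariant_defect_bilinear.

Variables (i0 i1 i2 : 'I_N).
Hypotheses (i01 : i0 != i1) (i02 : i0 != i2) (i12 : i1 != i2).
Hypotheses
 (E00 : f (e i0 i0) (e i0 i0) i0 i0 = x *+ 2 + y *+ 2 + u + v)
 (E01 : f (e i0 i0) (e i0 i0) i1 i1 = u + v)
 (K0 : f (e i0 i0) (e i1 i1) i0 i0 = y + v)
 (K2 : f (e i0 i0) (e i1 i1) i2 i2 = v).

(** The model being itself invariant, the defect is invariant; the four entry hypotheses make it
    vanish exactly at the entries that [lie_equivariant_eq0] asks for. *)
Lemma equivariant_defect_eq0 a b : equivariant_defect a b = 0.
Proof.
have dfE i j p : equivariant_defect (e i i) (e j j) p p =
    f (e i i) (e j j) p p - (x * (((p == i) && (i == j))%:R *+ 2) + y * (p == j)%:R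
     + y * (p == i)%:R + (u * (i == j)%:R + v)).
  rewrite /equivariant_defect !mxtrace_delta jor_delta mul_delta_mx_cond raddfMn /=.
  rewrite mxtrace_delta !eqxx !mulr1 !mxE !eqxx [j == i]eq_sym.
  have [->|ij] := eqVneq i j; rewrite ?mulr1n ?mulr0n !mxE !andbb; last first.
    by rewrite andbF mulr0n; ring.
  by rewrite andbT; ring.
apply: (@lie_equivariant_eq0 F N (HB.pack equivariant_defect) _ _ char2 i0 i1 i2) =>
  //=.
- by move=> {}a {}b; rewrite /equivariant_defect f_sym mxtrace_mulC /jor; mx_ring.
- move=> c {}a {}b; rewrite /equivariant_defect.
  rewrite !mxtrace_lie mxtrace_mul_lie.
  have := f_equiv c a b; move: (\tr (a *m lie c b)) (\tr (a *m b)) => s t.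
  have -> fab : lie c (fab - (x *: jor a b + (y * \tr a) *: b + (y * \tr b) *: a
      + (u * t + v * (\tr a * \tr b)) *: 1%:M))
    = lie c fab - (x *: lie c (jor a b) + (y * \tr a) *: lie c b + (y * \tr b) *:
      lie c a).
    by rewrite /lie; move: (jor a b) => w; mx_ring.
  move=> ->; rewrite lie_jor /jor; move: (lie c a) (lie c b) => a' b'; mx_ring.
- rewrite dfE E00 !eqxx /= ?mulr1n ?mulr0n; ring.
- rewrite dfE E01 eqxx eq_sym (negbTE i01) /= ?mulr1n ?mulr0n; ring.
- rewrite dfE K0 eqxx (negbTE i01) /= ?mulr1n ?mulr0n; ring.
- rewrite dfE K2 ![i2 == _]eq_sym (negbTE i02) (negbTE i12) (negbTE i01) /= ?mulr1n
  ?mulr0n; ring.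
Qed.

End BilinearClassification.
End EquivariantBilinear.

(** * Linear maps commuting with the Lie or the Jordan product *)

Section Centroids.

Variables (F : fieldType) (N : nat).
Local Notation M := 'M[F]_N.
Local Notation e i j := (delta_mx i j : M).
Implicit Types (a b c X : M) (i j k l p q : 'I_N).
Hypothesis char2 : 2%:R != 0 :> F.

(* Weights modulo the characteristic do not suffice here (in characteristic 3,
   twice a root is minus that root), whence the argument with commutants. *)
Lemma lie_equivariantP (f : {bilinear M -> M -> M}) : (2 < N)%N ->
  (forall a b, f a b = f b a) ->
  (forall c a b, lie c (f a b) = f (lie c a) b + f a (lie c b)) ->
  exists x y u v, forall a b,
    f a b = x *: jor a b + (y * \tr a) *: b + (y * \tr b) *: a
            + (u * \tr (a *m b) + v * (\tr a * \tr b)) *: 1%:M.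
Proof.
move=> N3 f_sym f_equiv.
pose i0 := Ordinal (ltn_trans (ltn0Sn 1) N3); pose i1 := Ordinal (ltnW N3); pose i2
  := Ordinal N3.
pose D := f (e i0 i0).
(* The parameters solve the four entry equations of [equivariant_defect_eq0]; 2 is inverted because
   [x] enters them only as [x *+ 2]. *)
pose v := D (e i1 i1) i2 i2; pose y := D (e i1 i1) i0 i0 - v.
pose u := D (e i0 i0) i1 i1 - v.
pose x := (D (e i0 i0) i0 i0 - D (e i0 i0) i1 i1) / 2%:R - y.
exists x, y, u, v => a b; apply/eqP; rewrite -subr_eq0; apply/eqP.
apply: (@equivariant_defect_eq0 _ _ char2 f f_sym f_equiv x y u v i0 i1 i2) => //;
  rewrite -/D /x /y /u /v; by field.
Qed.

(** Sending [a] to [\tr a *: 1%:M] also commutes with all [lie c], hence the restriction to trace 0.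
    The proof finds [f a = s *: a + \tr a *: Z] on all matrices. *)
Lemma lie_centroid (f : {linear M -> M}) : (1 < N)%N ->
  (forall c a, lie c (f a) = f (lie c a)) ->
  exists s, forall a, \tr a = 0 -> f a = s *: a.
Proof.
move=> N2 f_equiv; pose D i := f (e i i).
have D_diag i p q : p != q -> D i p q = 0.
  apply: lie_delta_diag_eq0 => k; rewrite f_equiv lie_delta eq_sym.
  by case: eqP => [->|_]; rewrite subrr linear0.
have D_const i k l : k != i -> l != i -> D i k k = D i l l.
  move=> ki li; apply: lie_delta_eq0; rewrite f_equiv lie_delta.
  by rewrite (negbTE li) eq_sym (negbTE ki) subrr linear0.
have f_ij i j : i != j -> f (e i j) = (D i i i - D i j j) *: e i j.
  move=> ij; have := f_equiv (e i j) (e i i).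
  rewrite -/(D i) (lie_delta_diag _ _ (@D_diag i)) lie_delta eqxx [j == i]eq_sym
    (negbTE ij).
  rewrite mulr1n mulr0n sub0r linearN => /eqP.
  by rewrite eq_sym eqr_oppLR -scaleNr opprB => /eqP.
have f_ij' i j : i != j -> f (e i j) = (D j j j - D j i i) *: e i j.
  move=> ij; have := f_equiv (e i j) (e j j).
  rewrite -/(D j) (lie_delta_diag _ _ (@D_diag j)) lie_delta eqxx [j == i]eq_sym
    (negbTE ij).
  by rewrite mulr1n mulr0n subr0.
(* The eigenvalue of [f] on [e i j]: constant along rows and symmetric, hence a single scalar. *)
pose al i j := D i i i - D i j j.
have al_sym i j : i != j -> al i j = al j i.
  move=> ij; have := f_ij i j ij; rewrite f_ij' // => /matrixP/(_ i j).
  by rewrite !mxE !eqxx !mulr1.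
have al_row i j k : i != j -> i != k -> al i j = al i k.
  by move=> ij ik; rewrite /al (D_const i j k) // eq_sym.
pose i0 := Ordinal (ltnW N2); pose i1 := Ordinal N2.
pose s := al i0 i1.
have alE i j : i != j -> al i j = s.
  move=> ij; have [E|i0i] := eqVneq i i0; first by rewrite E in ij *; apply: al_row.
  have i0i' : i0 != i by rewrite eq_sym.
  by rewrite (al_row i j i0 ij i0i) (al_sym _ _ i0i) (al_row i0 i i1).
have f_off i j : i != j -> f (e i j) = s *: e i j by move=> ij; rewrite f_ij //
  -/(al i j) alE.
pose Z := f (e i0 i0) - s *: e i0 i0.
(* [e i i - e i0 i0] is the bracket of [e i i0] and [e i0 i], so [f] multiplies it by [s]; all
   diagonal units thus share one error term [Z]. *)
have f_diag i : f (e i i) = s *: e i i + Z.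
  have [->|ii] := eqVneq i i0; first by rewrite addrC subrK.
  have := f_equiv (e i i0) (e i0 i); rewrite f_off 1?eq_sym // !lie_delta !eqxx
    !mulr1n.
  rewrite linearB /= /lie -scalemxAl -scalemxAr -scalerBr -/(lie _ _) lie_delta
    !eqxx !mulr1n.
  by move/eqP; rewrite eq_sym subr_eq => /eqP->; rewrite /Z scalerBr -addrA [- _ +
    _]addrC.
exists s => a a0.
have -> : f a = s *: a + \tr a *: Z; last by rewrite a0 scale0r addr0.
rewrite {2}[a]matrix_sum_delta scaler_sumr /mxtrace scaler_suml -big_split /=.
rewrite {1}[a]matrix_sum_delta linear_sum; apply: eq_bigr => i _.
rewrite linear_sum scaler_sumr (bigD1 i) // [in RHS](bigD1 i) //= linearZ /= f_diag.
rewrite scalerDr !scalerA [s * _]mulrC addrAC.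
congr (_ + _ + _).
by apply: eq_bigr => j ij; rewrite linearZ /= f_off 1?eq_sym // !scalerA mulrC.
Qed.

Lemma jor_deltaE i j X p q :
  jor (e i j) X p q = X j q *+ (p == i) + X p i *+ (q == j).
Proof.
rewrite -mul_deltaE -mulr_deltaE /jor.
by move: (_ *m _) (_ *m _) => A B; rewrite !mxE.
Qed.

Lemma jorC a b : jor a b = jor b a.
Proof. by rewrite /jor addrC. Qed.

Lemma jor0 a : jor a 0 = 0.
Proof. by rewrite /jor mulmx0 mul0mx addr0. Qed.

(** [f] is half the Jordan multiplication by [z = f 1]. For an idempotent [a], applying this twice
    gives [az + za = 2aza], so [z] commutes with [a]; enough idempotents make [z] scalar. *)
Lemma jor_centroid (f : {linear M -> M}) : (0 < N)%N ->
  (forall a b, f (jor a b) = jor a (f b)) -> exists s, forall a, f a = s *: a.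
Proof.
move=> N1 f_equiv; pose z := f 1%:M.
have f2 a : f a *+ 2 = jor a z by rewrite -f_equiv /jor mulmx1 mul1mx -mulr2n
  linearMn.
have z_idem a : a *m a = a -> lie a z = 0.
  move=> aa.
  have E : jor a z *+ 2 = jor a (jor a z).
    have Ja : jor a z = jor a (f a) by rewrite -f2 -f_equiv /jor aa -mulr2n linearMn.
    by rewrite {1}Ja -f2 !mulr2n /jor mulmxDr mulmxDl addrACA.
  have {}E : a *m z + z *m a = (a *m z *m a) *+ 2.
    move: E; rewrite /jor mulmxDr mulmxDl !mulmxA aa -(mulmxA z) aa.
    by rewrite mulr2n [X in _ = _ + X]addrC [RHS]addrACA -mulr2n => /addrI.
  have E1 : a *m z = a *m z *m a.
    have := congr1 (mulmx a) E; rewrite mulr2n !mulmxDr !mulmxA aa.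
    by move/addIr.
  have E2 : z *m a = a *m z *m a.
    have := congr1 (mulmxr a) E; rewrite /= mulr2n !mulmxDl -!mulmxA aa.
    by move/addrI.
  by rewrite /lie E1 E2 subrr.
(* [e i j] is the difference of the idempotents [e i i + e i j] and [e i i]. *)
have z_ij i j : i != j -> lie (e i j) z = 0.
  move=> ij; have ji : (j == i) = false by rewrite eq_sym (negbTE ij).
  have := z_idem (e i i + e i j).
  rewrite mulmxDl !mulmxDr !mul_delta_mx_cond !eqxx ji !mulr1n !mulr0n !addr0 => /(_
    erefl).
  rewrite /lie mulmxDl mulmxDr opprD addrACA -!/(lie _ _) z_idem ?add0r //.
  by rewrite mul_delta_mx_cond eqxx.
have z_diag p q : p != q -> z p q = 0.
  by apply: lie_delta_diag_eq0 => k; apply: z_idem; rewrite mul_delta_mx_cond eqxx.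
pose i0 := Ordinal N1; exists (z i0 i0) => a.
have zE : z = (z i0 i0)%:M.
  apply/matrixP => p q; rewrite mxE; have [<-|/z_diag//] := eqVneq p q.
  have [->//|p0] := eqVneq p i0; rewrite mulr1n.
  by apply: lie_delta_eq0; apply: z_ij.
apply: (scalerI char2); rewrite !scaler_nat f2 zE /jor mul_mx_scalar mul_scalar_mx
  mxE eqxx.
by rewrite mulr2n mulr1n.
Qed.

End Centroids.

(** * Skew Jordan biderivations *)

Section JordanBilinear.

Variables (F : fieldType) (N : nat).
Local Notation M := 'M[F]_N.
Local Notation e i j := (delta_mx i j : M).
Implicit Types (a b c X : M) (i j k l p q : 'I_N).
Hypothesis char2 : 2%:R != 0 :> F.

Lemma jor0l a : jor 0 a = 0.
Proof. by rewrite jorC jor0. Qed.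

Lemma jorNl a b : jor (- a) b = - jor a b.
Proof. by rewrite /jor mulmxN mulNmx opprD. Qed.

Lemma jorNr a b : jor a (- b) = - jor a b.
Proof. by rewrite jorC jorNl jorC. Qed.

Lemma jorZl s a b : jor (s *: a) b = s *: jor a b.
Proof. by rewrite /jor -scalemxAl -scalemxAr scalerDr. Qed.

Lemma jorZr s a b : jor a (s *: b) = s *: jor a b.
Proof. by rewrite jorC jorZl jorC. Qed.

(** The common Peirce space of [e k k] and [e l l], spanned by [e k l] and [e l k]; as [jor] carries
    no factor 1/2, the Peirce eigenvalue 1/2 reads 1. *)
Lemma jor_fixed_eq0 k l X : k != l -> jor (e k k) X = X -> jor (e l l) X = X ->
  forall p q, (p, q) != (k, l) -> (p, q) != (l, k) -> X p q = 0.
Proof.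
move=> kl Xk Xl p q; rewrite !xpair_eqE => pq1 pq2.
have Ek : X p q = X k q *+ (p == k) + X p k *+ (q == k) by rewrite -jor_deltaE Xk.
have El : X p q = X l q *+ (p == l) + X p l *+ (q == l) by rewrite -jor_deltaE Xl.
move: pq1 pq2 Ek El.
have [->|pk] := eqVneq p k; have [->|qk] := eqVneq q k;
  rewrite ?eqxx ?(negbTE kl) ?[k == l](negbTE kl) ?mulr1n ?mulr0n ?addr0 ?add0r //=.
- by case: eqP => //= _ _ _ _; rewrite mulr0n.
- by case: eqP => //= _ _ _ _; rewrite mulr0n.
Qed.

Variable f : {bilinear M -> M -> M}.
Hypothesis f_alt : forall a, f a a = 0.
Hypothesis f_skew : forall a b, f a b = - f b a.
Hypothesis f_der : forall c a b, f c (jor a b) = jor (f c a) b + jor a (f c b).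

Let jor_idem i : jor (e i i) (e i i) = (e i i) *+ 2.
Proof. by rewrite jor_delta eqxx mulr1n mulr2n. Qed.

Let jor_ii_jj i j : i != j -> jor (e i i) (e j j) = 0.
Proof. by move=> ij; rewrite jor_delta [j == i]eq_sym (negbTE ij) mulr0n addr0. Qed.

Let jor_ii_ij i j : i != j -> jor (e i i) (e i j) = e i j.
Proof. by move=> ij; rewrite jor_delta eqxx eq_sym (negbTE ij) mulr0n mulr1n addr0.
  Qed.

Let jor_jj_ij i j : i != j -> jor (e j j) (e i j) = e i j.
Proof. by move=> ij; rewrite jor_delta eqxx eq_sym (negbTE ij) mulr0n mulr1n add0r.
  Qed.

Let jor_kk_ij i j k : k != i -> k != j -> jor (e k k) (e i j) = 0.
Proof. by move=> ki kj; rewrite jor_delta [j == k]eq_sym (negbTE ki) (negbTE kj)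
  mulr0n addr0. Qed.

Let mul2_inj (X Y : M) : X *+ 2 = Y *+ 2 -> X = Y.
Proof. by rewrite -!scaler_nat => /(scalerI char2). Qed.

Let f_idem c i : jor (e i i) (f c (e i i)) = f c (e i i).
Proof.
apply: mul2_inj; rewrite -linearMnr -jor_idem f_der mulr2n.
by rewrite [X in _ = X + _]jorC.
Qed.

(** The derivation rule puts this element in the 0-eigenspace of [jor (e i i)], while skewness and
    [f_idem] put it in the 1-eigenspace. *)
Let f_ii_jj i j : f (e i i) (e j j) = 0.
Proof.
have [->|ij] := eqVneq i j; first exact: f_alt.
have := f_der (e i i) (e i i) (e j j).
rewrite jor_ii_jj // linear0r f_alt jor0l add0r f_skew => /esym.
by rewrite jorNr f_idem.
Qed.

Let f_fix k i j : i != j -> jor (e i i) (f (e k k) (e i j)) = f (e k k) (e i j) /\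
   jor (e j j) (f (e k k) (e i j)) = f (e k k) (e i j).
Proof.
move=> ij; split.
  by rewrite -[in RHS](jor_ii_ij ij) f_der f_ii_jj jor0l add0r.
by rewrite -[in RHS](jor_jj_ij ij) f_der f_ii_jj jor0l add0r.
Qed.

Let f_ii_ij i j : i != j -> f (e i i) (e i j) = (f (e i i) (e i j) i j) *: e i j.
Proof.
move=> ij; have [Ei Ej] := f_fix i ij.
set X := f _ _ in Ei Ej *; have X0 := jor_fixed_eq0 ij Ei Ej.
(* Only the coefficient on [e j i] is left to exclude; deriving [jor (e i j) (e i j) = 0] does
   so. *)
have Xji : X j i = 0.
  have := f_der (e i i) (e i j) (e i j); rewrite -/X [jor (e i j) X]jorC -mulr2n.
  rewrite {1}jor_delta [j == i]eq_sym (negbTE ij) !mulr0n addr0 linear0r => /esym E.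
  have {}E : jor X (e i j) = 0 by apply: mul2_inj; rewrite E mul0rn.
  have := congr1 (fun Y : M => Y j j) E.
  by rewrite jorC jor_deltaE mxE eqxx eq_sym (negbTE ij) mulr0n add0r mulr1n.
apply/matrixP => p q; rewrite !mxE.
have [/eqP[-> ->]|pq] := boolP ((p, q) == (i, j)); first by rewrite !eqxx mulr1.
have -> : (p == i) && (q == j) = false by rewrite -xpair_eqE (negbTE pq).
rewrite mulr0; have [/eqP[-> ->]//|qp] := boolP ((p, q) == (j, i)).
exact: X0.
Qed.

(** For [f = s *: lie] each of these numbers is [s]; in general they are shown to be all equal, so
    that [H01] annihilates them. *)
Let lam i j := f (e i i) (e i j) i j.

Let f_kk_ij i j k : k != i -> k != j -> i != j -> f (e k k) (e i j) = 0.
Proof.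
move=> ki kj ij; have := f_der (e i j) (e k k) (e i i).
rewrite jor_ii_jj // linear0r [f (e i j) (e i i)]f_skew f_ii_ij // -scaleNr => /esym.
rewrite jorZr jor_kk_ij // scaler0 addr0 f_skew jorNl jorC (f_fix k ij).1 => /eqP.
by rewrite oppr_eq0 => /eqP.
Qed.

Let f_jj_ij i j : i != j -> f (e j j) (e i j) = - lam i j *: e i j.
Proof.
move=> ij; have := f_der (e i j) (e i i) (e j j).
rewrite jor_ii_jj // linear0r [f (e i j) (e i i)]f_skew f_ii_ij // -scaleNr => /esym.
rewrite jorZl [jor (e i j) _]jorC jor_jj_ij // [f (e i j) (e j j)]f_skew jorNr
  (f_fix j ij).1 => /eqP.
by rewrite subr_eq0 => /eqP.
Qed.

(** [f (e i i)] kills [jor (e i j) (e j i) = e i i + e j j], and it acts on the two factors by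
    [lam i j] and [- lam j i]. *)
Let lam_sym i j : i != j -> lam i j = lam j i.
Proof.
move=> ij; have ji : j != i by rewrite eq_sym.
have := f_der (e i i) (e i j) (e j i).
rewrite jor_delta !eqxx !mulr1n linearDr !f_ii_jj addr0 f_ii_ij // f_jj_ij //.
rewrite jorZl jorZr jor_delta !eqxx !mulr1n.
rewrite -scalerDl => /matrixP/(_ i i)/esym; rewrite !mxE !eqxx (negbTE ij) addr0
  mulr1.
by move/eqP; rewrite subr_eq0 => /eqP.
Qed.

Let lam_row i j k : i != j -> i != k -> lam i j = lam i k.
Proof.
move=> ij ik; have [->//|jk] := eqVneq j k.
have := f_der (e i i) (e i j) (e j k).
rewrite {1}jor_delta eqxx [k == i]eq_sym (negbTE ik) mulr1n mulr0n addr0.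
rewrite [f _ (e j k)]f_kk_ij // jor0 addr0 (f_ii_ij ij) (f_ii_ij ik) jorZl jor_delta
  eqxx [k == i]eq_sym (negbTE ik) mulr1n mulr0n addr0.
by move/matrixP/(_ i k); rewrite !mxE !eqxx !mulr1.
Qed.

Variables (i0 i1 : 'I_N).
Hypotheses (i01 : i0 != i1) (H01 : f (e i0 i0) (e i0 i1) i0 i1 = 0).

Let lam0 i j : i != j -> lam i j = 0.
Proof.
move=> ij; have [E|ii] := eqVneq i i0; first by rewrite E in ij *; rewrite (@lam_row
  i0 j i1).
have ii' : i0 != i by rewrite eq_sym.
by rewrite (@lam_row i j i0) // lam_sym // (@lam_row i0 i i1).
Qed.

Let f_kk k X : f X (e k k) = 0.
Proof.
rewrite (matrix_sum_delta X) linear_sumlz big1 // => i _.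
rewrite linear_sumlz big1 // => j _; rewrite linearZl_LR /= f_skew.
have [->|ij] := eqVneq i j; first by rewrite f_ii_jj oppr0 scaler0.
have [->|ki] := eqVneq k i; first by rewrite f_ii_ij // -/(lam i j) lam0 // scale0r
  oppr0 scaler0.
have [->|kj] := eqVneq k j; first by rewrite f_jj_ij // lam0 // oppr0 scale0r oppr0
  scaler0.
by rewrite f_kk_ij // oppr0 scaler0.
Qed.

Let f_supp X i j : i != j ->
  forall p q, (p, q) != (i, j) -> (p, q) != (j, i) -> f X (e i j) p q = 0.
Proof.
move=> ij; apply: jor_fixed_eq0 => //.
  by rewrite -[in RHS](jor_ii_ij ij) f_der f_kk jor0l add0r.
by rewrite -[in RHS](jor_jj_ij ij) f_der f_kk jor0l add0r.
Qed.

(** By [f_supp] and skewness the value at [e i j], [e k l] is supported both on the positions ij, ji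
    and on kl, lk. These sets are disjoint unless the pairs agree up to order; equal pairs fall to
    [f_alt], opposite ones to [e k l] having square 0. *)
Lemma jordan_skew_derivation_eq0 a b : f a b = 0.
Proof.
apply: bilinear_eq0 => i j k l; have [->|kl] := eqVneq k l; first exact: f_kk.
have [->|ij] := eqVneq i j; first by rewrite f_skew f_kk oppr0.
have [E|n1] := boolP ((i, j) == (k, l)); first by case/eqP: E => -> ->; exact: f_alt.
have f_lk : f (e l k) (e k l) = 0.
  have Y u v : u != v -> f (e v u) (e u v) v u = 0.
    move=> uv; have := f_der (e v u) (e u v) (e u v); rewrite [jor (e u v) (f _
      _)]jorC -mulr2n.
    rewrite {1}jor_delta [v == u]eq_sym (negbTE uv) !mulr0n addr0 linear0r => /esym E.
    have {}E : jor (f (e v u) (e u v)) (e u v) = 0 by apply: mul2_inj; rewrite E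
      mul0rn.
    have := congr1 (fun Y : M => Y v v) E.
    by rewrite jorC jor_deltaE mxE eqxx eq_sym (negbTE uv) mulr0n add0r mulr1n.
  apply/matrixP => p q; rewrite mxE.
  have [/eqP[-> ->]|pq] := boolP ((p, q) == (k, l)).
    by rewrite f_skew mxE Y ?oppr0 // eq_sym.
  have [/eqP[-> ->]|qp] := boolP ((p, q) == (l, k)); first exact: Y.
  exact: f_supp.
have [E|n2] := boolP ((i, j) == (l, k)); first by case/eqP: E => -> ->.
apply/matrixP => p q; rewrite mxE.
have [E|pq] := boolP (((p, q) == (k, l)) || ((p, q) == (l, k))); last first.
  by move: pq; rewrite negb_or => /andP[pq qp]; exact: f_supp.
rewrite f_skew mxE f_supp ?oppr0 //.
  by case/orP: E => /eqP->; rewrite eq_sym //.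
case/orP: E => /eqP[-> ->]; rewrite eq_sym.
  by apply: contraNneq n2 => -[-> ->].
by apply: contraNneq n1 => -[-> ->].
Qed.

End JordanBilinear.

(** * Projections of a grading *)

Section GradedProjections.

Variables (F : fieldType) (G : zmodType) (V : vectType F).
Implicit Types (U : {vspace V}) (Gam : G -> {vspace V}).

Lemma seq_sumv_sup (s : seq G) Gam g :
  g \in s -> (Gam g <= \sum_(k <- s) Gam k)%VS.
Proof. by move=> gs; rewrite (big_rem g) //= addvSl. Qed.

Lemma seq_subv_sum (s : seq G) Gam U :
  (forall g, Gam g <= U)%VS -> (\sum_(k <- s) Gam k <= U)%VS.
Proof.
move=> sU; apply: (big_ind (fun W => W <= U)%VS) => // [|W1 W2 h1 h2].
  exact: sub0v.
by rewrite subv_add h1.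
Qed.

Lemma directv_seq (s : seq G) Gam :
  directv (\sum_(g <- s) Gam g) = directv (\sum_(i < size s) Gam (nth 0%R s i)).
Proof. by rewrite !directvE /= !(big_nth (0%R : G)) !big_mkord. Qed.

(** The projections are indexed by all of [G] and not only by the support [s], so that components in
    computed degrees such as [g + k + d] can be formed freely. *)
Definition graded_projections U Gam (s : seq G) (p : G -> 'End(V)) : Prop :=
  [/\ uniq s, forall g x, p g x \in Gam g,
      forall g k x, x \in Gam g -> p k x = if k == g then x else 0,
      forall x, x \in U -> \sum_(g <- s) p g x = x
    & forall g, (Gam g <= U)%VS].

Lemma decomposition_projections U Gam :
  decomposition U Gam -> exists s p, graded_projections U Gam s p.
Proof.
case=> s [s_uniq s_out s_dir s_sum].
have GamU g : (Gam g <= U)%VS.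
  have [gs|/s_out->] := boolP (g \in s); last exact: sub0v.
  by rewrite -s_sum; apply: seq_sumv_sup.
have sumU := esym s_sum; exists s, (sumv_pi_for sumU).
have pU x : x \in U -> \sum_(g <- s) sumv_pi_for sumU g x = x.
  by move=> xU; apply: sumv_pi_uniq_sum; rewrite ?filter_predT.
have pG g x : sumv_pi_for sumU g x \in Gam g by apply: memv_sum_pi.
split=> // g k x xg.
have [gs|gs] := boolP (g \in s); last first.
  by move: xg; rewrite s_out // memv0 => /eqP->; rewrite linear0; case: ifP.
have [ks|ks] := boolP (k \in s); last first.
  have -> : (k == g) = false by apply: contraNF ks => /eqP->.
  by apply/eqP; rewrite -memv0 -(s_out k ks).
move: s_dir; rewrite directv_seq => /directv_sum_independent indep.
(* The gap between actual and expected components; over [s] the gaps add up to [x - x], so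
   directness kills each of them. *)
pose u h := sumv_pi_for sumU h x - (if h == g then x else 0).
have ik : (index k s < size s)%N by rewrite index_mem.
suff: u (nth 0%R s (Ordinal ik)) = 0.
  by rewrite /u /= nth_index // => /eqP; rewrite subr_eq0 => /eqP.
apply: (indep (fun i => u (nth 0%R s i))) => // [i _|].
  by rewrite rpredB //; case: eqP => [->|_]; rewrite ?rpred0.
rewrite -(big_mkord xpredT (fun i => u (nth 0%R s i))).
rewrite -(big_nth (0%R : G) xpredT u).
rewrite big_split /= pU ?(subvP (GamU g)) // sumrN (bigD1_seq g) //= eqxx.
by rewrite big1 ?addr0 ?subrr // => h /negbTE->.
Qed.

(** Candidate projections detect directness: applied to a vanishing sum they isolate each summand.
    The list may repeat degrees, as unions of supports do, whence [undup]. *)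
Lemma projections_decomposition U Gam (s : seq G) (p : G -> V -> V) :
  (forall g, g \notin s -> Gam g = 0%VS) ->
  (forall g, {morph p g : x y / x + y}) ->
  (forall g k x, x \in Gam g -> p k x = if k == g then x else 0) ->
  (forall g, (Gam g <= U)%VS) -> (U <= \sum_(g <- s) Gam g)%VS ->
  decomposition U Gam.
Proof.
move=> s_out p_add p_delta GamU sU; exists (undup s); split.
- exact: undup_uniq.
- by move=> g; rewrite mem_undup; apply: s_out.
- rewrite directv_seq; apply/directv_sum_independent => us us_in us0 i _.
  have p0 g : p g 0 = 0 by apply: (addrI (p g 0)); rewrite -p_add !addr0.
  have := congr1 (p (nth 0%R (undup s) i)) us0; rewrite p0.
  rewrite (big_morph _ (p_add _) (p0 _)) (bigD1 i) //= (p_delta _ _ _ (us_in i isT))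
    eqxx.
  rewrite big1 ?addr0 // => j ji; rewrite (p_delta _ _ _ (us_in j isT)).
  by rewrite nth_uniq ?undup_uniq ?ltn_ord // eq_sym (inj_eq val_inj) (negbTE ji).
- apply/eqP; rewrite eqEsubv seq_subv_sum //; apply: subv_trans sU _.
  rewrite big_seq; apply: (big_ind (fun W => W <= _)%VS) => [|W1 W2 h1 h2|g gs].
  + exact: sub0v.
  + by rewrite subv_add h1.
  + by apply: seq_sumv_sup; rewrite mem_undup.
Qed.

Section Theory.

Variables (U : {vspace V}) (Gam : G -> {vspace V}) (s : seq G) (p : G -> 'End(V)).
Hypothesis Gp : graded_projections U Gam s p.

Lemma graded_mem g x : p g x \in Gam g. Proof. by case: Gp. Qed.

Lemma graded_delta g k x : x \in Gam g -> p k x = if k == g then x else 0.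
Proof. by case: Gp => ? ? + *; apply. Qed.

Lemma graded_id g x : x \in Gam g -> p g x = x.
Proof. by move=> xg; rewrite (graded_delta _ xg) eqxx. Qed.

Lemma graded_sum x : x \in U -> \sum_(g <- s) p g x = x.
Proof. by case: Gp => ? ? ? + ?; apply. Qed.

Lemma graded_sub g x : x \in Gam g -> x \in U.
Proof. by case: Gp => ? ? ? ? GU; apply: (subvP (GU g)). Qed.

Lemma graded_ind (P : V -> Prop) :
  P 0 -> (forall x y, P x -> P y -> P (x + y)) ->
  (forall g x, x \in Gam g -> P x) -> forall x, x \in U -> P x.
Proof.
move=> P0 PD Pg x xU; rewrite -(graded_sum xU).
by apply: (big_ind P) => // g _; apply: Pg (graded_mem g x).
Qed.

Lemma graded_disjoint g k x : x \in Gam g -> x \in Gam k -> g != k -> x = 0.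
Proof.
move=> xg xk gk; rewrite -(graded_id xk) (graded_delta k xg).
by rewrite eq_sym (negbTE gk).
Qed.

Lemma graded_out g x : g \notin s -> x \in Gam g -> x = 0.
Proof.
move=> gs xg; rewrite -(graded_sum (graded_sub xg)) big_seq big1 // => k ks.
by rewrite (graded_delta k xg); case: eqP ks => // ->; rewrite (negbTE gs).
Qed.

Lemma graded_sum_delta (W : zmodType) g x (f : G -> V -> W) :
  (forall k, f k 0 = 0) -> x \in Gam g -> \sum_(k <- s) f k (p k x) = f g x.
Proof.
move=> f0 xg; have [gs|gs] := boolP (g \in s); last first.
  rewrite (graded_out gs xg) f0 big1 // => k _.
  by rewrite linear0 f0.
have s_uniq : uniq s by case: Gp.
rewrite (bigD1_seq g) //= (graded_id xg) big1 ?addr0 // => k kg.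
by rewrite (graded_delta k xg) (negbTE kg) f0.
Qed.

End Theory.

(** This is how identities pass from a map to its homogeneous parts: multiplication by an element of
    degree [m] slides through the projections. *)
Lemma graded_shift_map U Gam s p U' Gam' s' p' (T : V -> V) m :
  graded_projections U Gam s p -> graded_projections U' Gam' s' p' ->
  T 0 = 0 -> {morph T : x y / x + y} ->
  (forall g x, x \in Gam g -> T x \in Gam' (m + g)) ->
  forall g x, x \in U -> p' (m + g) (T x) = T (p g x).
Proof.
move=> Gp Gp' T0 TD TG g; apply: (graded_ind Gp); first by rewrite T0 !linear0 T0.
  by move=> x y Ex Ey; rewrite TD !linearD /= TD Ex Ey.
move=> k x xk; rewrite (graded_delta Gp g xk) (graded_delta Gp' _ (TG _ _ xk)).
by rewrite (inj_eq (addrI m)); case: eqP.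
Qed.

End GradedProjections.

(** * Skew Jordan biderivations are multiples of the commutator *)

Section JordanSkewDerivation.

Variables (F : fieldType) (N : nat).
Local Notation M := 'M[F]_N.

Variables (f : {bilinear M -> M -> M}) (s : F).

Definition commutator_defect (a b : M) : M := f a b - s *: lie a b.

Lemma commutator_defect_bilinear : bilinear_for *:%R *:%R commutator_defect.
Proof.
split=> a t b c; rewrite /commutator_defect /lie.
  rewrite linearPl mulmxDl mulmxDr -scalemxAl -scalemxAr /=; mx_ring.
rewrite linearPr mulmxDl mulmxDr -scalemxAl -scalemxAr /=; mx_ring.
Qed.

HB.instance Definition _ := bilinear_isBilinear.Build F M M M *:%R *:%R
  commutator_defect commutator_defect_bilinear.

End JordanSkewDerivation.

Lemma jordan_skew_derivationP (F : fieldType) (N : nat) (char2 : 2%:R != 0 :> F)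
    (f : {bilinear 'M[F]_N -> 'M[F]_N -> 'M[F]_N}) : (1 < N)%N ->
  (forall a, f a a = 0) ->
  (forall c a b, f c (jor a b) = jor (f c a) b + jor a (f c b)) ->
  exists s, forall a b, f a b = s *: lie a b.
Proof.
move=> N2 f_alt f_der.
have f_skew a b : f a b = - f b a.
  apply/eqP; rewrite -addr_eq0; have := f_alt (a + b).
  by rewrite linearDl !linearDr /= !f_alt add0r addr0 => ->.
pose i0 := Ordinal (ltnW N2); pose i1 := Ordinal N2.
have E01 : lie (delta_mx i0 i0) (delta_mx i0 i1) = delta_mx i0 i1 :> 'M[F]_N.
  by rewrite lie_delta eqxx /= mulr1n mulr0n subr0.
(* By [E01] the commutator takes the value 1 at this entry, so the entry of [f] is the sought
   coefficient. *)
exists (f (delta_mx i0 i0) (delta_mx i0 i1) i0 i1) => a b; set s := f _ _ _ _.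
apply/eqP; rewrite -subr_eq0; apply/eqP.
apply: (@jordan_skew_derivation_eq0 F N char2 (HB.pack (commutator_defect f s)) _ _
  _ i0 i1) => //=.
- by move=> {}a; rewrite /commutator_defect f_alt /lie subrr scaler0 subrr.
- move=> {}a {}b; rewrite /commutator_defect f_skew /lie; mx_ring.
- move=> c {}a {}b; rewrite /commutator_defect f_der.
  move: (f c a) (f c b) => u v; rewrite /lie /jor; mx_ring.
- by rewrite /commutator_defect E01 !mxE !eqxx mulr1 subrr.
Qed.

(** * The products of Q(n), and reduction of the Lie case to all matrices *)

Section Products.

Variables (F : fieldType) (kind : Q_kind) (n : nat).
Local Notation N := (Qsize kind n).
Local Notation M := 'M[F]_N.
Local Notation S := (Qbase F kind n).
Local Notation even := (even_mul F kind n).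
Local Notation odd := (@odd_mul F kind n).
Implicit Types (a b c : M).

Lemma even_mul_bilinear : bilinear_for *:%R *:%R even.
Proof.
rewrite /even_mul; case: kind; split=> a t b c;
  rewrite mulmxDl mulmxDr -scalemxAl -scalemxAr /=; mx_ring.
Qed.

HB.instance Definition _ := bilinear_isBilinear.Build F M M M *:%R *:%R
  even even_mul_bilinear.

Lemma sharp_linear : linear (@sharp F kind n).
Proof.
by move=> t a b; rewrite /sharp mxtraceD mxtraceZ mulrDr mulrCA raddfD /=
  -(scale_scalar_mx _ t) scalerBr addrACA -opprD.
Qed.

HB.instance Definition _ := GRing.isLinear.Build F M M *:%R (@sharp F kind n)
  sharp_linear.

Lemma odd_mul_bilinear : bilinear_for *:%R *:%R odd.
Proof.
have sP := sharp_linear; rewrite /odd_mul; move: sP; case: (kind) => sP; split=> a t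
  b c;
  rewrite /= mulmxDl mulmxDr -scalemxAl -scalemxAr.
- by rewrite addrACA -scalerDr sP.
- by rewrite addrACA -scalerDr sP.
- by mx_ring.
- by mx_ring.
Qed.

HB.instance Definition _ := bilinear_isBilinear.Build F M M M *:%R *:%R
  odd odd_mul_bilinear.

End Products.

Section LieSharp.

Variables (F : fieldType) (n : nat).
Local Notation M := 'M[F]_n.+1.
Hypothesis char2 : 2%:R != 0 :> F.
Hypothesis charN : n.+1%:R != 0 :> F.
Hypothesis n2 : (2 <= n)%N.
Local Notation sharp := (@sharp F LieQ n).
Implicit Types (a b c : M).

Lemma mxtrace_sharp a : \tr (sharp a) = 0.
Proof. by rewrite raddfB /= mxtrace_scalar -[X in _ - X]mulr_natr mulrAC mulVf //
  mul1r subrr. Qed.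

Lemma sharp_id a : \tr a = 0 -> sharp a = a.
Proof. by rewrite /Defs.sharp => ->; rewrite mulr0 raddf0 subr0. Qed.

Lemma sharp_scalar t : sharp t%:M = 0.
Proof.
by rewrite /Defs.sharp mxtrace_scalar -[t *+ _]mulr_natl mulrA mulVf // mul1r subrr.
Qed.

Lemma lie_sharpl c a : lie (sharp c) a = lie c a.
Proof.
rewrite /Defs.sharp /lie mulmxBl mulmxBr mul_scalar_mx mul_mx_scalar.
by rewrite opprB addrA subrK.
Qed.

Lemma lie_sharpr c a : lie c (sharp a) = lie c a.
Proof. by rewrite lieC lie_sharpl -lieC. Qed.

(** [sharp] changes a matrix by a scalar, invisible to [lie]; so [f] composed with [sharp] is
    equivariant on all matrices and [lie_centroid] applies. *)
Lemma lie_traceless_centroid (f : {linear M -> M}) :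
  (forall c a, \tr c = 0 -> \tr a = 0 -> lie c (f a) = f (lie c a)) ->
  exists s, forall a, \tr a = 0 -> f a = s *: a.
Proof.
move=> f_equiv.
pose g (a : M) : M := f (sharp a).
have g_linear : linear g by move=> t a b; rewrite /g sharp_linear linearP.
pose gL := GRing.isLinear.Build F M M *:%R g g_linear.
have [||s gE] := @lie_centroid F n.+1 (HB.pack g gL); first exact: ltnW.
  move=> c a /=; rewrite /g -lie_sharpl f_equiv ?mxtrace_sharp // lie_sharpl
    lie_sharpr.
  by rewrite sharp_id // mxtrace_lie.
by exists s => a a0; rewrite -gE //= /g sharp_id.
Qed.

Section SharpMap.
Variable f : {bilinear M -> M -> M}.

Definition sharp_map a b : M := f (sharp a) (sharp b).

Lemma sharp_map_bilinear : bilinear_for *:%R *:%R sharp_map.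
Proof.
split=> a t b c; rewrite /sharp_map sharp_linear.
  exact: linearPl.
exact: linearPr.
Qed.

HB.instance Definition _ := bilinear_isBilinear.Build F M M M *:%R *:%R
  sharp_map sharp_map_bilinear.

End SharpMap.

(** On trace 0 the four-parameter form reduces to [jor] plus a scalar matrix; as [f] has traceless
    values, applying [sharp] removes that scalar. *)
Lemma lie_traceless_bilinear (f : {bilinear M -> M -> M}) :
  (forall a b, \tr a = 0 -> \tr b = 0 -> \tr (f a b) = 0) ->
  (forall a b, \tr a = 0 -> \tr b = 0 -> f a b = f b a) ->
  (forall c a b, \tr c = 0 -> \tr a = 0 -> \tr b = 0 ->
     lie c (f a b) = f (lie c a) b + f a (lie c b)) ->
  exists s, forall a b, \tr a = 0 -> \tr b = 0 -> f a b = s *: sharp (jor a b).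
Proof.
move=> f_tr f_sym f_equiv.
have [|||x [y [u [v fE]]]] := @lie_equivariantP F n.+1 char2 (HB.pack (sharp_map f)).
- by [].
- by move=> a b /=; rewrite /sharp_map f_sym ?mxtrace_sharp.
- move=> c a b /=; rewrite /sharp_map -lie_sharpl f_equiv ?mxtrace_sharp //.
  by rewrite !lie_sharpl !lie_sharpr !(sharp_id (mxtrace_lie _ _)).
exists x => a b a0 b0.
have {}fE : f a b = x *: jor a b + (u * \tr (a *m b)) *: 1%:M.
  by rewrite -[in LHS](sharp_id a0) -[in LHS](sharp_id b0) [LHS]fE a0 b0 !mulr0
    !scale0r !addr0.
by rewrite -(sharp_id (f_tr a b a0 b0)) fE sharp_linear scalemx1 sharp_scalar addr0.
Qed.

End LieSharp.

Section HomogeneousParts.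

Variables (F : fieldType) (G : zmodType) (V : vectType F).
Variables (U : {vspace V}) (Gam : G -> {vspace V}) (s : seq G) (p : G -> 'End(V)).
Hypothesis Gp : graded_projections U Gam s p.

Lemma graded_neq0 (W : zmodType) (T : V -> W) x :
  T 0 = 0 -> {morph T : x y / x + y} -> x \in U -> T x != 0 ->
  exists g, T (p g x) != 0.
Proof.
move=> T0 TD xU Tx; have [/hasP[g _ Tg]|/hasPn Ts] := boolP (has (fun g => T (p g x)
  != 0) s).
  by exists g.
case/eqP: Tx; rewrite -(graded_sum Gp xU) (big_morph T TD T0) big_seq big1 // => g gs.
by apply/eqP; have := Ts g gs; rewrite negbK.
Qed.

Variable f : {bilinear V -> V -> V}.
Variable d : G.

(** Cutting the arguments into components makes the part of degree [d] bilinear on the whole space,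
    as [odd_mul_unique] requires. *)
Definition degree_part (a b : V) : V :=
  \sum_(g <- s) \sum_(k <- s) p (g + k + d) (f (p g a) (p k b)).

Lemma degree_part_bilinear : bilinear_for *:%R *:%R degree_part.
Proof.
split=> a t b c; rewrite /degree_part /= scaler_sumr -big_split; apply: eq_bigr => g
  _;
  rewrite /= scaler_sumr -big_split; apply: eq_bigr => k _.
  by rewrite linearP linearPl linearP.
by rewrite linearP linearPr linearP.
Qed.

HB.instance Definition _ := bilinear_isBilinear.Build F V V V *:%R *:%R
  degree_part degree_part_bilinear.

Lemma degree_part_homogeneous g k a b : a \in Gam g -> b \in Gam k ->
  degree_part a b = p (g + k + d) (f a b).
Proof.
move=> ag bk; rewrite /degree_part.
rewrite (graded_sum_delta Gp (f := fun h y => \sum_(l <- s) p (h + l + d) (f y (p l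
  b))) _ ag) //.
  rewrite (graded_sum_delta Gp (f := fun l y => p (g + l + d) (f a y)) _ bk) // => l.
  by rewrite linear0r linear0.
by move=> h; rewrite big1 // => l _; rewrite linear0l linear0.
Qed.

End HomogeneousParts.

(** * The degree of the odd product *)

Section OddProductDegree.

Variables (F : fieldType) (kind : Q_kind) (n : nat) (G : zmodType).
Local Notation N := (Qsize kind n).
Local Notation M := 'M[F]_N.
Local Notation S := (Qbase F kind n).
Local Notation even := (even_mul F kind n).
Local Notation odd := (@odd_mul F kind n).
Implicit Types (a b c : M) (Gam : G -> {vspace M}).

Hypothesis char2 : 2%:R != 0 :> F.
Hypothesis charN : kind = LieQ -> n.+1%:R != 0 :> F.
Hypothesis n2 : (2 <= n)%N.

Lemma odd_mul_Qbase a b : odd a b \in S.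
Proof.
rewrite /odd_mul /Qbase; move: charN a b; case: kind => cN a b; last exact: memvf.
by rewrite trace0E mxtrace_sharp // cN.
Qed.

Lemma Qbase_products_neq0 :
  exists a b, [/\ a \in S, b \in S, even a b != 0 & odd a b != 0].
Proof.
rewrite /odd_mul /Qbase /even_mul; move: charN; case: kind => cN.
  pose i0 : 'I_n.+1 := ord0; pose i1 : 'I_n.+1 := Ordinal (ltnW n2 : (1 < n.+1)%N).
  pose i2 : 'I_n.+1 := Ordinal (n2 : (2 < n.+1)%N).
  have d_neq0 : delta_mx i0 i2 != 0 :> 'M[F]_n.+1.
    by apply/eqP => /matrixP/(_ i0 i2)/eqP; rewrite !mxE !eqxx oner_eq0.
  (* With three distinct indices the reversed product vanishes, so the bracket and the
     anticommutator are the same traceless unit. *)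
  exists (delta_mx i0 i1), (delta_mx i1 i2); rewrite !trace0E !mxtrace_delta.
  rewrite -/(lie _ _) -/(jor _ _) lie_delta jor_delta eqxx /= mulr1n mulr0n subr0
    addr0.
  by rewrite sharp_id ?mxtrace_delta // eqxx.
pose i0 : 'I_n := Ordinal (ltnW n2); pose i1 : 'I_n := Ordinal n2.
have d_neq0 : delta_mx i0 i1 != 0 :> 'M[F]_n.
  by apply/eqP => /matrixP/(_ i0 i1)/eqP; rewrite !mxE !eqxx oner_eq0.
exists (delta_mx i0 i0), (delta_mx i0 i1); rewrite !memvf.
by rewrite -/(lie _ _) -/(jor _ _) lie_delta jor_delta eqxx /= mulr1n mulr0n subr0
  addr0.
Qed.

Lemma Qbase_centroid (f : {linear M -> M}) :
  (forall c a, c \in S -> a \in S -> even c (f a) = f (even c a)) ->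
  exists s, forall a, a \in S -> f a = s *: a.
Proof.
rewrite /Qbase /even_mul; move: charN f; case: kind => cN f f_equiv.
  have [c a c0 a0|s fE] := lie_traceless_centroid (cN erefl) n2 (f := f).
    by apply: f_equiv; rewrite trace0E ?c0 ?a0.
  by exists s => a; rewrite trace0E => /eqP; apply: fE.
have [||s fE] := @jor_centroid F n char2 f; first exact: ltnW.
  by move=> a b; rewrite /jor -f_equiv ?memvf.
by exists s => a _; apply: fE.
Qed.

Lemma odd_mul_sym : kind = LieQ -> forall a b, odd a b = odd b a.
Proof. by rewrite /odd_mul; case: kind => // _ a b; rewrite addrC. Qed.

Lemma odd_mul_skew : kind = JordanQ -> forall a b, odd a b = - odd b a.
Proof. by rewrite /odd_mul; case: kind => // _ a b; rewrite opprB. Qed.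

Lemma even_mul_sym : kind = JordanQ -> forall a b, even a b = even b a.
Proof. by rewrite /even_mul; case: kind => // _ a b; rewrite addrC. Qed.

Lemma odd_mul_equiv : kind = LieQ -> forall c a b,
  even c (odd a b) = odd (even c a) b + odd a (even c b).
Proof.
rewrite /odd_mul /even_mul; case: kind => // _ c a b.
rewrite -!/(lie _ _) -!/(jor _ _) -raddfD /= -lie_jor lie_sharpr.
by rewrite sharp_id // mxtrace_lie.
Qed.

Lemma odd_mul_der : kind = JordanQ -> forall c a b,
  odd c (even a b) = even (odd c a) b + even a (odd c b).
Proof. by rewrite /odd_mul /even_mul; case: kind => // _ c a b; apply: lie_jor. Qed.

Lemma odd_mul_unique (f : {bilinear M -> M -> M}) :
  (forall a b, f a b \in S) ->
  (kind = LieQ -> forall a b, f a b = f b a) ->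
  (kind = JordanQ -> forall a b, f a b = - f b a) ->
  (kind = LieQ -> forall c a b, c \in S -> a \in S -> b \in S ->
     even c (f a b) = f (even c a) b + f a (even c b)) ->
  (kind = JordanQ -> forall c a b, c \in S -> a \in S -> b \in S ->
     f c (even a b) = even (f c a) b + even a (f c b)) ->
  exists t, forall a b, a \in S -> b \in S -> f a b = t *: odd a b.
Proof.
rewrite /Qbase /even_mul /odd_mul; move: charN f; case: kind => cN f f_mem f_sym
  f_skew f_equiv f_der.
  have [a b _ _|a b _ _|c a b c0 a0 b0|t fE] := lie_traceless_bilinear char2 (cN
    erefl) n2 (f := f).
  - by have := f_mem a b; rewrite trace0E => /eqP.
  - exact: f_sym.
  - by apply: f_equiv; rewrite ?trace0E ?c0 ?a0 ?b0.
  by exists t => a b; rewrite !trace0E => /eqP a0 /eqP b0; apply: fE.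
have [|c a b|t fE] := jordan_skew_derivationP char2 (f := f) n2.
- move=> a; apply: (scalerI char2); rewrite scaler0 scaler_nat mulr2n.
  by rewrite [X in X + _]f_skew // addNr.
- by apply: f_der; rewrite ?memvf.
by exists t => a b _ _; apply: fE.
Qed.

Section OneGrading.

Variable Gam : G -> {vspace M}.
Variables (s : seq G) (p : G -> 'End(M)).
Hypothesis Gp : graded_projections S Gam s p.
Hypothesis Gmul : forall g k a b, a \in Gam g -> b \in Gam k -> even a b \in Gam (g
  + k).

Lemma even_mul_shift m g c a : c \in Gam m -> a \in S ->
  p (m + g) (even c a) = even c (p g a).
Proof.
move=> cm aS; apply: (graded_shift_map Gp Gp (T := even c)) => //.
- exact: linear0r.
- exact: linearDr.
- by move=> k x xk; apply: Gmul.
Qed.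

(** Exchanging the two sums gives the symmetry; on homogeneous arguments [even_mul_shift] moves even
    multiplications through the projections, which gives the derivation property. *)
Lemma degree_part_scalar d :
  exists t, forall a b, a \in S -> b \in S -> degree_part s p odd d a b = t *: odd a
    b.
Proof.
pose f : {bilinear M -> M -> M} := HB.pack (degree_part s p odd d).
have fE g k a b : a \in Gam g -> b \in Gam k -> f a b = p (g + k + d) (odd a b).
  by move=> ag bk; apply: (degree_part_homogeneous Gp).
apply: (odd_mul_unique (f := f)).
- move=> a b; apply: rpred_sum => g _; apply: rpred_sum => k _.
  by apply: (graded_sub Gp (graded_mem Gp _ _)).
- move=> kindE a b; rewrite /f /= /degree_part exchange_big /=; apply: eq_bigr => g _.
  apply: eq_bigr => k _; rewrite [k + g]addrC; congr (p _ _).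
  exact: odd_mul_sym.
- move=> kindE a b; rewrite /f /= /degree_part exchange_big /= -sumrN; apply:
  eq_bigr => g _.
  rewrite -sumrN; apply: eq_bigr => k _.
  by rewrite [k + g]addrC -linearN; congr (p _ _); apply: odd_mul_skew.
- move=> kindE c a b cS aS bS.
  move: c cS; apply: (graded_ind Gp) => [|x y Ex Ey|m c cm].
  + by rewrite !(linear0l, linear0r) addr0.
  + by rewrite !(linearDl, linearDr) /= Ex Ey addrACA.
  move: a aS; apply: (graded_ind Gp) => [|x y Ex Ey|g a ag].
  + by rewrite !(linear0l, linear0r) addr0.
  + by rewrite !(linearDl, linearDr) /= Ex Ey addrACA.
  move: b bS; apply: (graded_ind Gp) => [|x y Ex Ey|k b bk].
  + by rewrite !(linear0l, linear0r) addr0.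
  + by rewrite !(linearDl, linearDr) /= Ex Ey addrACA.
  rewrite (fE _ _ _ _ ag bk) (fE _ _ _ _ (Gmul cm ag) bk) (fE _ _ _ _ ag (Gmul cm
    bk)).
  rewrite -(even_mul_shift _ cm (odd_mul_Qbase _ _)) odd_mul_equiv // linearD.
  by rewrite !addrA [g + m]addrC.
- move=> kindE c a b cS aS bS.
  move: c cS; apply: (graded_ind Gp) => [|x y Ex Ey|m c cm].
  + by rewrite !(linear0l, linear0r) addr0.
  + by rewrite !(linearDl, linearDr) /= Ex Ey addrACA.
  move: a aS; apply: (graded_ind Gp) => [|x y Ex Ey|g a ag].
  + by rewrite !(linear0l, linear0r) addr0.
  + by rewrite !(linearDl, linearDr) /= Ex Ey addrACA.
  move: b bS; apply: (graded_ind Gp) => [|x y Ex Ey|k b bk].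
  + by rewrite !(linear0l, linear0r) addr0.
  + by rewrite !(linearDl, linearDr) /= Ex Ey addrACA.
  rewrite (fE _ _ _ _ cm (Gmul ag bk)) (fE _ _ _ _ cm ag) (fE _ _ _ _ cm bk).
  (* Commutativity of the even product brings the homogeneous factor to the left, where
     [even_mul_shift] applies. *)
  rewrite odd_mul_der // linearD /= [in RHS]even_mul_sym // [in LHS]even_mul_sym //.
  rewrite -(even_mul_shift _ bk (odd_mul_Qbase _ _)) -(even_mul_shift _ ag
    (odd_mul_Qbase _ _)).
  have -> : k + (m + g + d) = m + (g + k) + d.
    by rewrite [g + k]addrC [m + (k + g)]addrCA -!addrA.
  by have -> : g + (m + k + d) = m + (g + k) + d by rewrite [m + (g + k)]addrCA
    -!addrA.
Qed.

Lemma odd_mul_homogeneous :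
  exists h0, forall g k a b, a \in Gam g -> b \in Gam k -> odd a b \in Gam (g + k +
    h0).
Proof.
have [a [b [aS bS _ ab]]] := Qbase_products_neq0.
have [g ga] := graded_neq0 Gp (T := odd^~ b) (linear0l _ _) (linearDl _ _) aS ab.
have [k kb] := graded_neq0 Gp (T := odd (p g a)) (linear0r _ _) (linearDr _ _) bS ga.
have [j jab] := graded_neq0 Gp (T := id) erefl (fun x y => erefl) (odd_mul_Qbase _
  _) kb.
have Dga := graded_mem Gp g a; have Dkb := graded_mem Gp k b.
set a' := p g a in Dga kb jab; set b' := p k b in Dkb kb jab.
(* The degree is read off one nonzero component of one homogeneous product; the part of that degree
   is [t] times [odd] with [t] nonzero, so [odd] is itself homogeneous. *)
exists (j - (g + k)); have [t tE] := degree_part_scalar (j - (g + k)).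
have t0 : t != 0.
  apply: contraNneq jab => t0.
  have := tE a' b' (graded_sub Gp Dga) (graded_sub Gp Dkb).
  by rewrite t0 scale0r (degree_part_homogeneous Gp _ _ Dga Dkb) addrC subrK => ->.
move=> g' k' x y xg yk.
have := tE x y (graded_sub Gp xg) (graded_sub Gp yk).
rewrite (degree_part_homogeneous Gp _ _ xg yk) => E.
have <- : t^-1 *: (t *: odd x y) = odd x y by rewrite scalerA mulVf ?scale1r.
by rewrite -E rpredZ // (graded_mem Gp).
Qed.

(** Tested on one homogeneous pair with nonzero odd product: a degree [h1] other than 0 and [h2]
    would leave that product no component. *)
Lemma odd_mul_degree_unique h1 h2 :
  (forall g k a b, a \in Gam g -> b \in Gam k -> odd a b \in Gam (g + k + h1)) ->
  (forall g k a b, a \in Gam g -> b \in Gam k ->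
     odd a b \in (Gam (g + k) + Gam (g + k + h2))%VS) ->
  h1 = 0 \/ h1 = h2.
Proof.
move=> H1 H2; have [a [b [aS bS _ ab]]] := Qbase_products_neq0.
have [g ga] := graded_neq0 Gp (T := odd^~ b) (linear0l _ _) (linearDl _ _) aS ab.
have [k kb] := graded_neq0 Gp (T := odd (p g a)) (linear0r _ _) (linearDr _ _) bS ga.
have Dga := graded_mem Gp g a; have Dkb := graded_mem Gp k b.
have [h10|h10] := eqVneq h1 0; [by left | right].
apply/eqP; apply: contraNT kb => h12.
have E := H1 _ _ _ _ Dga Dkb; rewrite -(graded_id Gp E).
have /memv_addP[u ug [v vg ->]] := H2 _ _ _ _ Dga Dkb.
rewrite linearD /= (graded_delta Gp _ ug) (graded_delta Gp _ vg).
have -> : (g + k + h1 == g + k) = false by rewrite addrC -subr_eq0 addrK (negbTE h10).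
by rewrite (inj_eq (addrI _)) (negbTE h12) addr0.
Qed.

End OneGrading.
End OddProductDegree.

(** * Type I gradings *)

Section TypeOne.

Variables (F : fieldType) (kind : Q_kind) (n : nat).
Local Notation N := (Qsize kind n).
Local Notation M := 'M[F]_N.
Local Notation S := (Qbase F kind n).
Local Notation even := (even_mul F kind n).
Local Notation odd := (@odd_mul F kind n).
Implicit Types (a b c : M).

Hypothesis char2 : 2%:R != 0 :> F.
Hypothesis charN : kind = LieQ -> n.+1%:R != 0 :> F.
Hypothesis n2 : (2 <= n)%N.

(** For [y] of degree g, the degree g component of [y *m 1] is [y] times the degree 0 component of
    1. That component is therefore a right identity, hence equal to 1. *)
Lemma one_degree0 (G : zmodType) (Th : G -> {vspace M}) :
  grading mulmx fullv Th -> 1%:M \in Th 0.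
Proof.
case=> /decomposition_projections[s [t Tp]] Tm.
have e0 (x : M) : x *m t 0 1%:M = x.
  move: x (memvf x : x \in fullv); apply: (graded_ind Tp).
  - by rewrite mul0mx.
  - by move=> y z Ey Ez; rewrite mulmxDl Ey Ez.
  move=> g y yg; rewrite -(graded_shift_map (m := g) Tp Tp (T := mulmx y)) ?memvf //.
  - by rewrite addr0 mulmx1 (graded_id Tp).
  - exact: mulmx0.
  - exact: mulmxDr.
  by move=> k z zk; apply: Tm.
by rewrite -[X in X \in _]e0 mul1mx (graded_mem Tp).
Qed.

Lemma odd_mul_cases a b :
  odd a b = a *m b - b *m a \/ kind = LieQ /\ odd a b = sharp (a *m b + b *m a).
Proof. by rewrite /odd_mul; case: kind a b => a b; [right | left]. Qed.

Lemma sharp_Qbase a : kind = LieQ -> sharp a \in S.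
Proof.
rewrite /Qbase; move: charN a; case: kind => // cN a _.
by rewrite trace0E mxtrace_sharp ?cN.
Qed.

Lemma sharp_Qbase_id a : kind = LieQ -> a \in S -> sharp a = a.
Proof.
rewrite /Qbase; move: a; case: kind => // a _.
by rewrite trace0E => /eqP; apply: sharp_id.
Qed.

(** [Gam] enters through an induction principle, which a coarsening inherits at once from the finer
    grading. *)
Lemma typeI_odd_mul (G : zmodType) (Gam : G -> {vspace M}) :
  (forall P : M -> Prop, P 0 -> (forall x y, P x -> P y -> P (x + y)) ->
     (forall g x, x \in Gam g -> P x) -> forall x, x \in S -> P x) ->
  typeI Gam ->
  forall g k a b, a \in Gam g -> b \in Gam k -> odd a b \in Gam (g + k).
Proof.
move=> Gind [Th [Thg res]] g k a b; have Th1 := one_degree0 Thg.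
case: Thg => /decomposition_projections[s [t Tp]] Tm.
rewrite -!res !memv_cap => /andP[ag _] /andP[bk _]; rewrite odd_mul_Qbase // andbT.
have ab := Tm _ _ _ _ ag bk; have := Tm _ _ _ _ bk ag; rewrite addrC => ba.
case: (odd_mul_cases a b) => [->|[kE ->]]; first by rewrite rpredB.
set w := _ + _; have {ab ba} wTh : w \in Th (g + k) by rewrite rpredD.
have c1 (c : F) : (c%:M : M) \in Th 0 by rewrite -scalemx1 rpredZ.
have [l0|l0] := eqVneq (g + k) 0; first by rewrite /sharp rpredB // l0.
suff wS : w \in S by rewrite sharp_Qbase_id.
(* Scalars have degree 0, so in a nonzero degree [w] is a component of [sharp w]. As S is spanned by
   homogeneous elements it contains that component, so [w] is already traceless. *)
have -> : w = t (g + k) (sharp w).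
  by rewrite linearB /= (graded_id Tp wTh) (graded_delta Tp _ (c1 _)) (negbTE l0)
    subr0.
move: (sharp w) (sharp_Qbase w kE); apply: Gind.
- by rewrite linear0 rpred0.
- by move=> x y Ex Ey; rewrite linearD rpredD.
move=> j x; rewrite -res memv_cap => /andP[xj xS].
by rewrite (graded_delta Tp _ xj); case: eqP; rewrite ?rpred0.
Qed.

Lemma coarsening_odd_mul (G : zmodType) (Gam : G -> {vspace M}) s p h (h2 : h *+ 2 =
  0) :
  graded_projections S Gam s p -> typeI (coarsening h2 Gam) ->
  forall g k a b, a \in Gam g -> b \in Gam k ->
    odd a b \in (Gam (g + k)%R + Gam (g + k + h)%R)%VS.
Proof.
move=> Gp tI g k a b ag bk; rewrite -(coarseningE h2).
have coarse j x : x \in Gam j -> x \in coarsening h2 Gam (\pi_(Quotient.quot (cyc2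
  h2))%qT j).
  by move=> xj; rewrite coarseningE; apply: subvP xj; apply: addvSl.
rewrite raddfD; apply: typeI_odd_mul => //; try exact: coarse.
move=> P P0 PD Pg; apply: (graded_ind Gp) => // j x xj.
exact: Pg (coarse j x xj).
Qed.

End TypeOne.

(** * The trace form and the adjunction of 1 in the Lie case *)

Section LieTraceForm.

Variables (F : fieldType) (n : nat) (G : zmodType).
Local Notation M := 'M[F]_n.+1.
Hypothesis char2 : 2%:R != 0 :> F.
Hypothesis charN : n.+1%:R != 0 :> F.
Hypothesis n2 : (2 <= n)%N.
Local Notation sharp := (@sharp F LieQ n).
Local Notation S := (Qbase F LieQ n).
Implicit Types (a b c : M).

Lemma jor_sharp a b : jor a (sharp b) = jor a b - (2%:R * (n.+1%:R^-1 * \tr b)) *: a.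
Proof.
rewrite /jor mulmxBr mulmxBl mul_mx_scalar mul_scalar_mx addrACA -opprD -scalerDl.
by rewrite mulr_natl mulr2n.
Qed.

(** The associator of [jor] alone is [lie (lie a c) b]. Each inner [sharp] adds a correction with
    one factor 2 from [jor_sharp] and one from the trace of an anticommutator, whence the 4. *)
Lemma sharp_jor_associator a b c : \tr a = 0 -> \tr b = 0 -> \tr c = 0 ->
  sharp (jor a (sharp (jor b c))) - sharp (jor (sharp (jor a b)) c)
  = lie (lie a c) b
    - (4%:R * n.+1%:R^-1) *: (\tr (b *m c) *: a - \tr (a *m b) *: c).
Proof.
move=> a0 b0 c0; rewrite (jorC (sharp _)) !jor_sharp.
have trj x y : \tr (jor x y) = 2%:R * \tr (x *m y).
  by rewrite mxtraceD [\tr (y *m x)]mxtrace_mulC mulr_natl mulr2n.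
have sD (r : F) x y : sharp (x - r *: y) = sharp x - r *: sharp y.
  by rewrite linearB linearZ.
rewrite !trj !sD (sharp_id a0) (sharp_id c0) opprD opprK addrACA -linearB /=.
have -> : jor a (jor b c) - jor c (jor a b) = lie (lie a c) b by rewrite /jor /lie;
  mx_ring.
rewrite (sharp_id (mxtrace_lie _ _)); congr (_ + _).
rewrite scalerBr !scalerA opprD opprK -!scaleNr; congr (_ *: _ + _ *: _); ring.
Qed.

Variables (Gam : G -> {vspace M}) (s : seq G) (p : G -> 'End(M)).
Hypothesis Gp : graded_projections S Gam s p.
Hypothesis Gmul : forall g k a b, a \in Gam g -> b \in Gam k -> lie a b \in Gam (g +
  k).
Hypothesis Godd : forall g k a b, a \in Gam g -> b \in Gam k -> sharp (jor a b) \in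
  Gam (g + k).

(* By the associator identity, v = tr(bc) a - tr(ab) c has degree g + k + m; if
   tr(ab) <> 0 and g + k <> 0, its component in degree m shows that c is a
   multiple of a, so that S would be a line. *)
Lemma trace_form_degree0 g k a b : a \in Gam g -> b \in Gam k -> g + k != 0 ->
  \tr (a *m b) = 0.
Proof.
move=> ag bk gk; apply/eqP; apply: contraNT gk => tab.
have tr0 j x : x \in Gam j -> \tr x = 0.
  by move=> xj; apply/eqP; have := graded_sub Gp xj; rewrite /Qbase trace0E.
have [c [c' [cS c'S cc' _]]] := @Qbase_products_neq0 F LieQ n (fun=> charN) n2.
apply: contraNT cc' => gk.
suff line : forall x, x \in S -> x \in <[a]>%VS.
  have /vlineP[u ->] := line c cS; have /vlineP[v ->] := line c' c'S.
  by rewrite linearZlr /= subrr !scaler0.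
apply: (graded_ind Gp) => {c c' cS c'S}.
- exact: rpred0.
- by move=> x y; apply: rpredD.
move=> m c cm; pose v := \tr (b *m c) *: a - \tr (a *m b) *: c.
have vG : v \in Gam (g + k + m).
  have k0 : 4%:R * n.+1%:R^-1 != 0 :> F.
    by rewrite mulf_neq0 ?invr_eq0 // (natrM _ 2 2) mulf_neq0.
  rewrite -[v](scalerK k0) rpredZ //.
  have := sharp_jor_associator (tr0 _ _ ag) (tr0 _ _ bk) (tr0 _ _ cm).
  rewrite -/v => /eqP; rewrite eq_sym subr_eq addrC -subr_eq => /eqP <-.
  apply: rpredB.
    by rewrite addrAC; apply: (Gmul _ bk); apply: Gmul.
  apply: rpredB; first by rewrite -addrA; apply: Godd => //; apply: Godd.
  by apply: Godd => //; apply: Godd.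
have mN : (m == g + k + m) = false by rewrite eq_sym -subr_eq0 addrK (negbTE gk).
have := graded_delta Gp m vG; rewrite mN.
rewrite linearB !linearZ /= (graded_id Gp cm) (graded_delta Gp _ ag) scalerN => /eqP.
rewrite subr_eq0 => /eqP E.
rewrite -[c](scalerK tab) rpredZ // -E rpredZ //.
by case: eqP => _; rewrite ?memv_line ?rpred0.
Qed.

End LieTraceForm.

Section AdjoinOne.

Variables (F : fieldType) (n : nat) (G : zmodType).
Local Notation M := 'M[F]_n.+1.
Hypothesis char2 : 2%:R != 0 :> F.
Hypothesis charN : n.+1%:R != 0 :> F.
Hypothesis n2 : (2 <= n)%N.
Local Notation sharp := (@sharp F LieQ n).
Local Notation S := (Qbase F LieQ n).
Variable Gam : G -> {vspace M}.

(** By [one_degree0] the identity must have degree 0, so this is the only candidate for a grading of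
    the matrix algebra restricting to [Gam]. *)
Definition adjoin_one (g : G) : {vspace M} :=
  (Gam g + (if g == 0%R then <[1%:M : M]> else 0))%VS.

Lemma adjoin_oneP g x :
  reflect (exists2 a, a \in Gam g & exists t, x = a + t%:M /\ (g != 0 -> t = 0))
    (x \in adjoin_one g).
Proof.
apply: (iffP memv_addP) => [[a ag [w wg ->]]|[a ag [t [-> gt]]]].
  exists a => //; move: wg; case: eqP => [_ /vlineP[t ->]|_].
    by exists t; rewrite scalemx1.
  by rewrite memv0 => /eqP->; exists 0; rewrite raddf0.
exists a => //; exists t%:M => //; case: eqP gt => [_ _|_ -> //].
  by rewrite -(scalemx1 _ t) rpredZ // memv_line.
by rewrite raddf0 rpred0.
Qed.

Hypothesis Ggr : grading (@lie F n.+1) S Gam.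
Hypothesis Godd : forall g k a b, a \in Gam g -> b \in Gam k -> sharp (jor a b) \in
  Gam (g + k).

Lemma lie_degree0_typeI : @typeI F LieQ n G Gam.
Proof.
case: Ggr => /decomposition_projections[s [p Gp]] Gmul.
have trS (x : M) : (x \in S) = (\tr x == 0) := @trace0E F LieQ n x.
have tr0 g (x : M) : x \in Gam g -> \tr x = 0.
  by move=> xg; apply/eqP; rewrite -trS; apply: (graded_sub Gp xg).
have sharp_t x : x = sharp x + (n.+1%:R^-1 * \tr x)%:M by rewrite /Defs.sharp subrK.
exists adjoin_one; split; last first.
  move=> g; apply/vspaceP => x; rewrite memv_cap trS.
  apply/andP/idP => [[/adjoin_oneP[a ag [t [-> _]]]]|xg].
    rewrite mxtraceD (tr0 _ _ ag) add0r mxtrace_scalar -mulr_natr mulf_eq0 (negbTE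
      charN) orbF.
    by move=> /eqP->; rewrite raddf0 addr0.
  split; last by rewrite (tr0 _ _ xg).
  by apply/adjoin_oneP; exists x => //; exists 0; rewrite raddf0 addr0.
split.
  pose P g x : M := p g (sharp x) + (if g == 0 then (n.+1%:R^-1 * \tr x)%:M else 0).
  have sub g : (Gam g <= adjoin_one g)%VS by apply: addvSl.
  (* Degree 0 is added for the identity matrix; it may already occur in [s]. *)
  apply: (projections_decomposition (s := 0 :: s) (p := P)) => //.
  - move=> g; rewrite inE negb_or => /andP[/negbTE g0 gs]; rewrite /adjoin_one g0
    addv0.
    apply/eqP; rewrite -subv0; apply/subvP => x xg.
    by rewrite (graded_out Gp gs xg) rpred0.
  - move=> g x y; rewrite /P (linearD sharp) (linearD (p g)) mxtraceD mulrDr (raddfD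
    scalar_mx).
    by case: eqP => _; rewrite ?addr0 // addrACA.
  - move=> g k x /adjoin_oneP[a ag [t [-> gt]]].
    have trx : n.+1%:R^-1 * \tr (a + t%:M) = t.
      by rewrite mxtraceD (tr0 _ _ ag) add0r mxtrace_scalar -[t *+ _]mulr_natr mulrC
        mulfK.
    rewrite /P trx (linearD sharp) /= sharp_scalar // addr0 sharp_id ?(tr0 _ _ ag) //.
    rewrite (graded_delta Gp k ag); have [->//|kg] := eqVneq k g.
      by case: eqP gt => // /eqP g0 -> //; rewrite raddf0.
    by rewrite add0r; case: eqP => // k0; rewrite gt ?raddf0 // -k0 eq_sym.
  - by move=> g; apply: subvf.
  - apply/subvP => x _; rewrite [x]sharp_t rpredD //.
      have := sharp_Qbase (fun=> charN) x erefl.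
      rewrite -/(sharp x); move: (sharp x); apply: (graded_ind Gp).
      + exact: rpred0.
      + by move=> y z; apply: rpredD.
      move=> g y yg; have [gs|gs] := boolP (g \in s); last by rewrite (graded_out Gp
        gs yg) rpred0.
      apply: (subvP (seq_sumv_sup (g := g) adjoin_one _)); first by rewrite inE gs
        orbT.
      exact: (subvP (sub g)).
    apply: (subvP (seq_sumv_sup (g := 0) adjoin_one _)); first by rewrite inE eqxx.
    apply/adjoin_oneP; exists 0; first exact: rpred0.
    by exists (n.+1%:R^-1 * \tr x); rewrite add0r eqxx.
move=> g k _ _ /adjoin_oneP[a ag [t [-> gt]]] /adjoin_oneP[b bk [u [-> ku]]].
have sub j x : x \in Gam j -> x \in adjoin_one j by apply: subvP; apply: addvSl.
rewrite mulmxDl !mulmxDr -scalar_mxM mul_scalar_mx mul_mx_scalar.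
apply: rpredD; apply: rpredD.
- have -> : a *m b = 2%:R^-1 *: (lie a b + sharp (jor a b))
     + (2%:R^-1 * (n.+1%:R^-1 * \tr (jor a b)))%:M.
    rewrite -(scale_scalar_mx _ 2%:R^-1) -scalerDr -addrA -sharp_t /lie /jor.
    by rewrite addrACA addNr addr0 -mulr2n -scaler_nat scalerA mulVf ?scale1r.
  apply/adjoin_oneP; exists (2%:R^-1 *: (lie a b + sharp (jor a b))).
    by rewrite rpredZ // rpredD // ?Gmul ?Godd.
  exists (2%:R^-1 * (n.+1%:R^-1 * \tr (jor a b))); split=> // gk.
  (* Outside degree 0 the scalar part of the product must vanish, which is the content of
     [trace_form_degree0]. *)
  rewrite mxtraceD [\tr (b *m a)]mxtrace_mulC.
  by rewrite (trace_form_degree0 char2 charN n2 Gp Gmul Godd ag bk gk) addr0 !mulr0.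
- have [k0|k0] := eqVneq k 0; last by rewrite ku // scale0r rpred0.
  by rewrite k0 addr0 rpredZ // sub.
- have [g0|g0] := eqVneq g 0; last by rewrite gt // scale0r rpred0.
  by rewrite g0 add0r rpredZ // sub.
have [g0|g0] := eqVneq g 0; last by rewrite gt // mul0r raddf0 rpred0.
have [k0|k0] := eqVneq k 0; last by rewrite ku // mulr0 raddf0 rpred0.
apply/adjoin_oneP; exists 0; first exact: rpred0.
by exists (t * u); rewrite add0r g0 k0 addr0 eqxx.
Qed.

End AdjoinOne.

Section Degree.

Variables (F : fieldType) (kind : Q_kind) (n : nat) (G : zmodType).
Local Notation N := (Qsize kind n).
Local Notation M := 'M[F]_N.
Local Notation S := (Qbase F kind n).
Local Notation even := (even_mul F kind n).
Local Notation odd := (@odd_mul F kind n).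

Hypothesis char2 : 2%:R != 0 :> F.
Hypothesis charN : kind = LieQ -> n.+1%:R != 0 :> F.
Hypothesis n2 : (2 <= n)%N.

Lemma odd_degree0_typeI (Gam : G -> {vspace M}) : grading even S Gam ->
  (forall g k a b, a \in Gam g -> b \in Gam k -> odd a b \in Gam (g + k)) -> typeI
    Gam.
Proof.
move: charN Gam; rewrite /even_mul /odd_mul; case: kind => cN Gam Ggr Godd.
  exact: lie_degree0_typeI (cN erefl) n2 _ Ggr Godd.
exists Gam; split; last by move=> g; rewrite /Qbase capvf.
case: Ggr => Gd Gmul; split=> // g k a b ag bk.
have -> : a *m b = 2%:R^-1 *: ((a *m b + b *m a) + (a *m b - b *m a)).
  by rewrite addrACA subrr addr0 -mulr2n -scaler_nat scalerA mulVf ?scale1r.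
by rewrite rpredZ // rpredD // ?Gmul ?Godd.
Qed.

(** For Type II, the coarsening confines the degree of [odd] to 0 or [h], and degree 0 would make
    [Gam] of Type I. *)
Lemma distinguished_degree (Gam : G -> {vspace M}) h : grading even S Gam ->
  distinguished Gam h ->
  forall g k a b, a \in Gam g -> b \in Gam k -> odd a b \in Gam (g + k + h).
Proof.
move=> Ggr hdist; have [/decomposition_projections[s [p Gp]] Gmul] := Ggr.
have [[tI ->]|[ntI h0 [h2 tI]]] := hdist => g k a b ag bk.
  rewrite addr0; apply: typeI_odd_mul tI _ _ _ _ ag bk => // P P0 PD Pg.
  exact: (graded_ind Gp).
have [d Hd] := odd_mul_homogeneous char2 charN n2 Gp Gmul.
have H2 := coarsening_odd_mul charN Gp tI.
have [d0|<-] := odd_mul_degree_unique charN n2 Gp Hd H2; last exact: Hd.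
case: ntI; apply: odd_degree0_typeI => // g' k' a' b' ag' bk'.
by have := Hd _ _ _ _ ag' bk'; rewrite d0 addr0.
Qed.

End Degree.

(** * Gradings of the superalgebra *)

Section SuperGradings.

Variables (F : fieldType) (kind : Q_kind) (n : nat) (G : zmodType).
Local Notation N := (Qsize kind n).
Local Notation M := 'M[F]_N.
Local Notation S := (Qbase F kind n).
Local Notation even := (even_mul F kind n).
Local Notation odd := (@odd_mul F kind n).
Local Notation Q0 := (Qeven F kind n).
Local Notation Q1 := (Qodd F kind n).

Hypothesis char2 : 2%:R != 0 :> F.
Hypothesis charN : kind = LieQ -> n.+1%:R != 0 :> F.
Hypothesis n2 : (2 <= n)%N.

Lemma even_underlineE (U W : {vspace M}) (x : M * M) :
  (x \in evenv U + underline W)%VS = (x.1 \in U) && (x.2 \in W).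
Proof.
apply/memv_addP/andP => [[u uU [w wW ->]]|[x1 x2]].
  move: uU wW; rewrite !pairvE !memv0 => /andP[u1 /eqP u2] /andP[/eqP w1 w2].
  by rewrite /= u2 w1 addr0 add0r.
exists (x.1, 0); first by rewrite pairvE x1 memv0 eqxx.
exists (0, x.2); first by rewrite pairvE x2 memv0 eqxx.
by case: x {x1 x2} => u w; rewrite -[RHS]/(u + 0, 0 + w) addr0 add0r.
Qed.

Section OneGrading.

Variables (Gam : G -> {vspace M}) (h : G).
Hypothesis Ggr : grading even S Gam.
Hypothesis Godd : forall g k a b, a \in Gam g -> b \in Gam k -> odd a b \in Gam (g +
  k + h).

Section Extension.

Variables (d : G) (Del : G -> {vspace M * M}).
Hypothesis dh : d *+ 2 = h.
Hypothesis DelE : forall g x, (x \in Del g) = (x.1 \in Gam g) && (x.2 \in Gam (g -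
  d)).

Lemma extension_grading :
  super_grading (Qmul F kind n) Q0 Q1 Del
  /\ restricts_to Q0 Del (fun g => evenv (Gam g)).
Proof.
have [/decomposition_projections[s [p Gp]] Gmul] := Ggr.
have Gsub g x : x \in Gam g -> x \in S by apply: (graded_sub Gp).
have D0 g x : (x, 0) \in Del g = (x \in Gam g) by rewrite DelE rpred0 andbT.
have D1 g x : (0, x) \in Del g = (x \in Gam (g - d)) by rewrite DelE rpred0.
have split_pair (x : M * M) : x = (x.1, 0) + (0, x.2).
  by case: x => u w; rewrite -[RHS]/(u + 0, 0 + w) addr0 add0r.
split; last first.
  move=> g; apply/vspaceP => x; rewrite memv_cap DelE !pairvE memv0.
  apply/andP/andP => [[/andP[x1 _] /andP[_ x2]]|[x1 /eqP x2]]; first by [].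
  by rewrite x1 x2 rpred0 eqxx (Gsub _ _ x1).
split; last first.
  move=> g; apply/eqP; rewrite eqEsubv subv_add !capvSl !andbT.
  apply/subvP => x; rewrite DelE => /andP[x1 x2]; rewrite [x]split_pair.
  apply: memv_add; rewrite memv_cap ?D0 ?D1 ?x1 ?x2 pairvE /= memv0 eqxx ?andbT /=.
    exact: Gsub x1.
  exact: Gsub x2.
split.
  (* The even part is supported on [s], the odd part on its translate by [d]. *)
  pose t := s ++ [seq g + d | g <- s].
  pose P g (x : M * M) := (p g x.1, p (g - d) x.2).
  apply: (projections_decomposition (s := t) (p := P)).
  - move=> g; rewrite mem_cat negb_or => /andP[g1 g2].
    have {}g2 : g - d \notin s.
      by apply: contra g2 => g2; apply/mapP; exists (g - d); rewrite ?subrK.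
    apply/eqP; rewrite -subv0; apply/subvP => -[u w]; rewrite DelE /= => /andP[ug wg].
    by rewrite (graded_out Gp g1 ug) (graded_out Gp g2 wg) rpred0.
  - by move=> g x y; rewrite /P /= !linearD.
  - move=> g k [u w]; rewrite DelE /P /= => /andP[ug wg].
    rewrite (graded_delta Gp _ ug) (graded_delta Gp _ wg) (inj_eq (addIr _)).
    by case: eqP.
  - by move=> g; apply/subvP => x; rewrite DelE even_underlineE => /andP[/Gsub->
    /Gsub->].
  - apply/subvP => x; rewrite even_underlineE [x in x \in _]split_pair => /andP[x1
    x2].
    apply: rpredD.
      move: x.1 x1; apply: (graded_ind Gp); first exact: rpred0.
        by move=> u w ut wt; have := rpredD ut wt; rewrite -[_ + _]/(u + w, 0 + 0)
          addr0.
      move=> g u ug; have [gs|gs] := boolP (g \in s); last by rewrite (graded_out Gp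
        gs ug) rpred0.
      apply: (subvP (seq_sumv_sup (g := g) Del _)); last by rewrite D0.
      by rewrite mem_cat gs.
    move: x.2 x2; apply: (graded_ind Gp); first exact: rpred0.
      by move=> u w ut wt; have := rpredD ut wt; rewrite -[_ + _]/(0 + 0, u + w)
        addr0.
    move=> g u ug; have [gs|gs] := boolP (g \in s); last by rewrite (graded_out Gp
      gs ug) rpred0.
    apply: (subvP (seq_sumv_sup (g := g + d) Del _)); last by rewrite D1 addrK.
    by rewrite mem_cat (map_f (fun i => i + d) gs) orbT.
move=> g k x y; rewrite !DelE /= => /andP[x1 x2] /andP[y1 y2].
apply/andP; split; apply: rpredD.
- exact: Gmul.
- by have := Godd x2 y2; rewrite -dh mulr2n addrACA !subrK.
- by rewrite -addrA; apply: Gmul.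
by rewrite addrAC; apply: Gmul.
Qed.

End Extension.

Section Restriction.

Definition odd_inj (x : M) : M * M := (0, x).

Lemma odd_inj_linear : linear odd_inj.
Proof. by move=> t x y; rewrite /odd_inj -[RHS]/(t *: 0 + 0, _) scaler0 addr0. Qed.

HB.instance Definition _ := GRing.isLinear.Build F M (M * M)%type *:%R odd_inj
  odd_inj_linear.

Variable Del : G -> {vspace M * M}.
Hypothesis Dgr : super_grading (Qmul F kind n) Q0 Q1 Del.
Hypothesis Dres : restricts_to Q0 Del (fun g => evenv (Gam g)).

Definition odd_component (g : G) : {vspace M} := (linfun odd_inj @^-1: Del g)%VS.

Lemma odd_componentE g x : (x \in odd_component g) = ((0, x) \in Del g).
Proof. by rewrite -memv_preim lfunE. Qed.

Lemma super_gradingE g x : (x \in Del g) = (x.1 \in Gam g) && (x.2 \in odd_component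
  g).
Proof.
have split_pair : x = (x.1, 0) + (0, x.2).
  by case: x => u w; rewrite -[RHS]/(u + 0, 0 + w) addr0 add0r.
apply/idP/andP => [|[x1 x2]].
  rewrite Dgr.2 => /memv_addP[u uD [w wD ->]].
  move: uD; rewrite Dres pairvE memv0 => /andP[u1 /eqP u2].
  move: wD; rewrite memv_cap pairvE memv0 => /andP[wg /andP[/eqP w1 w2]].
  rewrite odd_componentE /= w1 addr0 u2 add0r; split=> //.
  by rewrite -w1 -surjective_pairing.
rewrite split_pair rpredD // -?odd_componentE //.
have : (x.1, 0) \in evenv (Gam g) by rewrite pairvE /= x1 memv0 eqxx.
by rewrite -Dres memv_cap => /andP[].
Qed.

Lemma odd_component_projections :
  exists s q, graded_projections S odd_component s q.
Proof.
have [[/decomposition_projections[s [P DP]] _] _] := Dgr.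
exists s, (fun g => (linfun snd \o P g \o linfun odd_inj)%VF).
have qE g x : (linfun snd \o P g \o linfun odd_inj)%VF x = (P g (0, x)).2.
  by rewrite !comp_lfunE !lfunE.
split; first by case: DP.
- move=> g x; rewrite qE; have := graded_mem DP g (0, x).
  by rewrite super_gradingE => /andP[].
- move=> g k x; rewrite odd_componentE qE => xg; rewrite (graded_delta DP _ xg).
  by case: eqP.
- move=> x xS; under eq_bigr do rewrite qE.
  have xU : (0, x) \in (Q0 + Q1)%VS by rewrite even_underlineE rpred0.
  by rewrite -(raddf_sum snd) /= (graded_sum DP xU).
- move=> g; apply/subvP => x; rewrite odd_componentE => xg.
  by have := graded_sub DP xg; rewrite even_underlineE => /andP[].
Qed.

(** A nonzero homogeneous part of the identity, from S graded by [Gam] to S graded by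
    [odd_component], commutes with even multiplications and is thus a nonzero scalar on S; this
    fixes the shift. *)
Lemma restriction_shift :
  exists d, d *+ 2 = h /\ forall g, odd_component g = Gam (g - d).
Proof.
have [/decomposition_projections[s [p Gp]] Gmul] := Ggr.
have [t [q Dq]] := odd_component_projections.
have Dmul : forall g k x y, x \in Del g -> y \in Del k -> Qmul F kind n x y \in Del
  (g + k).
  by case: Dgr => -[].
have D1mul g k a x : a \in Gam g -> x \in odd_component k -> even a x \in
  odd_component (g + k).
  move=> ag xk; rewrite odd_componentE.
  have aD : (a, 0) \in Del g by rewrite super_gradingE ag rpred0.
  rewrite odd_componentE in xk; have := Dmul _ _ _ _ aD xk.
  by rewrite /Qmul /= !linear0l !linear0r !addr0.
have D1odd g k a b : a \in odd_component g -> b \in odd_component k -> odd a b \in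
  Gam (g + k).
  rewrite !odd_componentE => ag bk; have := Dmul _ _ _ _ ag bk.
  by rewrite super_gradingE /Qmul /= linear0l add0r => /andP[].
have [a [b [aS bS _ ab]]] := Qbase_products_neq0 charN n2.
have [g ga] := graded_neq0 Gp (T := odd^~ b) (linear0l _ _) (linearDl _ _) aS ab.
have a0 : p g a != 0 by apply: contraNneq ga => ->; rewrite linear0l.
have Dga := graded_mem Gp g a; set a' := p g a in a0 Dga ga.
have [k ka] := graded_neq0 Dq (T := id) erefl (fun x y => erefl) (graded_sub Gp Dga)
  a0.
(* [a'] has degree g in [Gam] and a nonzero component of degree k for [odd_component], so the part
   [th] of degree [d] does not kill it. *)
pose d := k - g.
pose th : 'End(M) := (\sum_(j <- s) (q (j + d) \o p j))%VF.
have thE j x : x \in Gam j -> th x = q (j + d) x.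
  move=> xj; rewrite sum_lfunE; under eq_bigr do rewrite comp_lfunE.
  by rewrite (graded_sum_delta Gp (f := fun i y => q (i + d) y) _ xj) // => i;
    rewrite linear0.
have th_equiv c x : c \in S -> x \in S -> even c (th x) = th (even c x).
  move=> cS xS; move: c cS; apply: (graded_ind Gp) => [|y z Ey Ez|m c cm].
  - by rewrite !linear0l linear0.
  - by rewrite !linearDl /= Ey Ez linearD.
  move: x xS; apply: (graded_ind Gp) => [|y z Ey Ez|j x xj].
  - by rewrite !(linear0r, linear0).
  - by rewrite !(linearDr, linearD) /= Ey Ez.
  rewrite (thE _ _ xj) (thE _ _ (Gmul _ _ _ _ cm xj)) -addrA.
  apply/esym; apply: (graded_shift_map Dq Dq (T := even c)) => //.
  - exact: linear0r.
  - exact: linearDr.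
  - by move=> i y; apply: D1mul.
  exact: (graded_sub Gp xj).
have [r rE] : exists r, forall x, x \in S -> th x = r *: x.
  exact: (Qbase_centroid char2 charN n2 (f := th)).
have r0 : r != 0.
  apply: contraNneq ka => r0; have := rE a' (graded_sub Gp Dga).
  by rewrite (thE _ _ Dga) r0 scale0r addrC subrK => ->.
have GD j x : x \in Gam j -> x \in odd_component (j + d).
  move=> xj; have := rE x (graded_sub Gp xj); rewrite (thE _ _ xj) => E.
  by rewrite -[x](scalerK r0) -E rpredZ // (graded_mem Dq).
have DG j : odd_component j = Gam (j - d).
  (* One inclusion is [GD]. Since the spaces [Gam i] span S, it makes the projections of the two
     gradings agree up to the shift, which gives the other. *)
  apply/vspaceP => x; apply/idP/idP => [xj|/GD]; last by rewrite subrK.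
  have xS := graded_sub Dq xj.
  have <- : p (j - d) x = x; last exact: (graded_mem Gp).
  have <- : q j x = p (j - d) x; last exact: (graded_id Dq).
  have E y : y \in S -> q j y = p (j - d) y; last exact: E.
  move: y; apply: (graded_ind Gp) => [|y z Ey Ez|i y yi].
  - by rewrite !linear0.
  - by rewrite !linearD /= Ey Ez.
  rewrite (graded_delta Gp _ yi) (graded_delta Dq _ (GD _ _ yi)).
  by rewrite subr_eq.
exists d; split => //.
(* A nonzero odd product of homogeneous elements has degree [g + k' + h] by [Godd] and
   [(g + d) + (k' + d)] as a product of odd elements of [Del]; hence [d + d = h]. *)
have [k' kb] := graded_neq0 Gp (T := odd a') (linear0r _ _) (linearDr _ _) bS ga.
have Dkb := graded_mem Gp k' b; set b' := p k' b in kb Dkb.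
have E1 := Godd Dga Dkb; have E2 := D1odd _ _ _ _ (GD _ _ Dga) (GD _ _ Dkb).
apply/eqP; rewrite eq_sym; apply: contraNT kb => hd.
apply/eqP; apply: (graded_disjoint Gp E1 E2).
by rewrite addrACA -mulr2n (inj_eq (addrI _)).
Qed.

End Restriction.

End OneGrading.

End SuperGradings.

Theorem theorem5p1
  (F : closedFieldType) (charF : 2%N \notin [pchar F])
  (kind : Q_kind) (n : nat) (n_ge2 : (2 <= n)%N)
  (charF_Lie : kind = LieQ -> forall p, p \in [pchar F] -> ~~ (p %| n.+1)%N)
  (G : zmodType)
  (Gam : G -> {vspace 'M[F]_(Qsize kind n)})
  (Gam_grading : grading (even_mul F kind n) (Qbase F kind n) Gam)
  (h : G) (h_dist : distinguished Gam h)
  (Del : G -> {vspace 'M[F]_(Qsize kind n) * 'M[F]_(Qsize kind n)}) :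
  (super_grading (Qmul F kind n) (Qeven F kind n) (Qodd F kind n) Del
   /\ restricts_to (Qeven F kind n) Del (fun g => evenv (Gam g)))
  <->
  (exists d : G, d *+ 2 = h
   /\ forall g, Del g = grading_sum (fun k => evenv (Gam k))
                          (shift d (fun k => underline (Gam k))) g).
Proof.
have char2 : 2%:R != 0 :> F by move: charF; rewrite inE.
have charN : kind = LieQ -> n.+1%:R != 0 :> F.
  move=> /charF_Lie charNp; apply/negP => N0.
  have [p pF] := natf0_pchar (ltn0Sn n) N0.
  by have := charNp p pF; rewrite (dvdn_pcharf pF) N0.
have Godd := distinguished_degree char2 charN n_ge2 Gam_grading h_dist.
split=> [[Dgr Dres]|[d [dh DelE]]].
  have [d [dh DE]] := restriction_shift char2 charN n_ge2 Gam_grading Godd Dgr Dres.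
  exists d; split=> // g; apply/vspaceP => x.
  by rewrite (super_gradingE Dgr Dres) DE /grading_sum /shift even_underlineE.
apply: (extension_grading Gam_grading Godd dh) => g x.
by rewrite DelE /grading_sum /shift even_underlineE.
Qed.
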